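(* For each integer $n \ge 0$ there exists a separable metric space $\mathbb{U}_n$ such that \[ \operatorname{asdim} \mathbb{U}_n = \operatorname{udim} \mathbb{U}_n = n \] and such that for each separable metric space $X$ the following conditions are satisfied. (a) If $\operatorname{asdim} X \leq n$, then $X$ is coarsely equivalent to a subset of $\mathbb{U}_n$. (b) If $\operatorname{udim} X \leq n$, then $X$ is uniformly homeomorphic to a subset of $\mathbb{U}_n$.
   Context: For an open cover $\mathcal{U}$ of a metric space $X$: the mesh of $\mathcal{U}$ is $\sup\{\operatorname{diam} U : U \in \mathcal{U}\}$; the multiplicity of $\mathcal{U}$ is the largest $k$ such that some $k$ (distinct) elements of $\mathcal{U}$ have non-empty intersection; a number $\epsilon > 0$ is a Lebesgue number for $\mathcal{U}$ if every subset of $X$ of diameter less than $\epsilon$ is contained in a member of $\mathcal{U}$. Uniform covering dimension: $\operatorname{udim} X \le n$ if for each $r > 0$ there exists an open cover of $X$ with mesh smaller than $r$, with a positive Lebesgue number, and with multiplicity at most $n+1$. Asymptotic dimension: $\operatorname{asdim} X \le n$ if for each $r < \infty$ there exists an open cover of $X$ with a Lebesgue number greater than $r$, with finite mesh, and with multiplicity at most $n+1$. In both cases, equality with $n$ means that the dimension is $\le n$ but not $\le n-1$. Let $f \colon X \to Y$ be a function between metric spaces (not assumed continuous). Consider non-decreasing functions $\varrho_1, \varrho_2 \colon (0,\infty) \to [0,\infty]$ such that $\varrho_1(d(x_1,x_2)) \le d(f(x_1), f(x_2)) \le \varrho_2(d(x_1,x_2))$ for all distinct $x_1, x_2 \in X$.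 The function $f$ is: - large scale uniform, if such $\varrho_1,\varrho_2$ can be chosen with $\varrho_2(r) < \infty$ for each $r$; - a coarse embedding, if they can be chosen so that $\varrho_2(r)<\infty$ for each $r$ and $\lim_{r\to\infty} \varrho_1(r) = \infty$; - a coarse equivalence, if it is a coarse embedding whose image is $r$-dense in $Y$ for some $r < \infty$; - uniformly continuous, if they can be chosen with $\lim_{r \to 0} \varrho_2(r) = 0$; - a uniform embedding, if they can be chosen with $\lim_{r\to 0}\varrho_2(r) = 0$ and $\varrho_1(r) > 0$ for each $r$; - a uniform homeomorphism, if it is a uniform embedding onto $Y$. $X$ is coarsely equivalent (respectively, uniformly homeomorphic) to a subset of $\mathbb{U}_n$ if there are a subset $A \subset \mathbb{U}_n$, with the restricted metric, and a coarse equivalence (respectively, uniform homeomorphism) $X \to A$. *)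

(* Defs.v *)
From HB Require Import structures.
From mathcomp Require Import all_boot all_order all_algebra.
From mathcomp Require Import all_classical all_reals all_analysis.

Set Implicit Arguments.
Unset Strict Implicit.
Unset Printing Implicit Defensive.

Import Order.TTheory GRing.Theory Num.Theory.
Import numFieldNormedType.Exports.

Local Open Scope classical_set_scope.
Local Open Scope ring_scope.

(* The restricted metric on a subset; the library already equips [set_type A]
   with the induced topology, uniformity and balls. *)
Section restricted_metric.
Context {R : realType} {X : metricType R} (A : set X).

Let sub_mdist (x y : A) : R := mdist (val x) (val y).

Let sub_mdist_ge0 x y : 0 <= sub_mdist x y.
Proof. exact: mdist_ge0. Qed.

Let sub_mdist_positivity x y : sub_mdist x y = 0 -> x = y.
Proof. by move=> /mdist_positivity /val_inj. Qed.

Let sub_ballEmdist (x : A) (d : R) : ball x d = [set y | sub_mdist x y < d].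
Proof.
by rewrite predeqE => y; rewrite /ball /= /initial_ball /= ballEmdist.
Qed.

HB.instance Definition _ := PseudoMetric_isMetric.Build R (set_type A)
  sub_mdist_ge0 sub_mdist_positivity sub_ballEmdist.

End restricted_metric.

Definition separable (T : topologicalType) : Prop :=
  exists2 S : set T, countable S & dense S.

Section dimensions.
Context {R : realType} {X : metricType R}.
Implicit Types (A : set X) (U : set (set X)).

(* Suprema are taken in [0, +oo], so that the empty set has diameter 0
   (and the empty family has mesh 0) instead of -oo. *)
Definition diam A : \bar R :=
  ereal_sup (0%E |` [set (mdist z.1 z.2)%:E | z in A `*` A]).

Definition mesh U : \bar R := ereal_sup (0%E |` [set diam V | V in U]).

Definition open_cover U : Prop :=
  (forall V, U V -> open V) /\ \bigcup_(V in U) V = setT.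

(* The bound is an integer so that it also makes sense in dimension < 0. *)
Definition multiplicity_le U (m : int) : Prop :=
  forall (k : nat) (F : set (set X)),
    F `<=` U -> (F #= `I_k)%card -> \bigcap_(V in F) V !=set0 -> k%:Z <= m.

Definition lebesgue_number U (e : R) : Prop :=
  0 < e /\ forall A, (diam A < e%:E)%E -> exists2 V, U V & A `<=` V.

End dimensions.

Section dimensions_le.
Context {R : realType}.
Implicit Types (X : metricType R) (n : int).

Definition udim_le X n : Prop :=
  forall r : R, 0 < r -> exists U : set (set X),
    [/\ open_cover U, (mesh U < r%:E)%E, exists e, lebesgue_number U e
      & multiplicity_le U (n + 1)].

Definition asdim_le X n : Prop :=
  forall r : R, exists U : set (set X),
    [/\ open_cover U, exists2 e, r < e & lebesgue_number U e,
        (mesh U < +oo)%E & multiplicity_le U (n + 1)].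

Definition udim_eq X n : Prop := udim_le X n /\ ~ udim_le X (n - 1).

Definition asdim_eq X n : Prop := asdim_le X n /\ ~ asdim_le X (n - 1).

End dimensions_le.

Section maps.
Context {R : realType}.
Implicit Types (X Y : metricType R) (rho : R -> \bar R).

(* A non-decreasing function (0, +oo) -> [0, +oo]; the values of [rho]
   outside (0, +oo) are irrelevant. *)
Definition gauge rho : Prop :=
  (forall r : R, 0 < r -> (0 <= rho r)%E) /\
  (forall r s : R, 0 < r -> r <= s -> (rho r <= rho s)%E).

Definition controlled X Y (f : X -> Y) rho1 rho2 : Prop :=
  [/\ gauge rho1, gauge rho2 &
      forall x1 x2, x1 <> x2 ->
        (rho1 (mdist x1 x2) <= (mdist (f x1) (f x2))%:E)%E /\
        ((mdist (f x1) (f x2))%:E <= rho2 (mdist x1 x2))%E].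

Definition coarse_embedding X Y (f : X -> Y) : Prop :=
  exists rho1 rho2,
    [/\ controlled f rho1 rho2,
        forall r : R, 0 < r -> (rho2 r < +oo)%E
      & rho1 r @[r --> +oo%R] --> +oo%E].

Definition r_dense Y (r : R) (B : set Y) : Prop :=
  forall y, exists2 b, B b & mdist y b <= r.

Definition coarse_equivalence X Y (f : X -> Y) : Prop :=
  coarse_embedding f /\ exists r, r_dense r (range f).

Definition uniform_embedding X Y (f : X -> Y) : Prop :=
  exists rho1 rho2,
    [/\ controlled f rho1 rho2,
        rho2 r @[r --> 0^'+] --> 0%E
      & forall r : R, 0 < r -> (0 < rho1 r)%E].

Definition uniform_homeomorphism X Y (f : X -> Y) : Prop :=
  uniform_embedding f /\ range f = setT.

Definition coarsely_equivalent_to_subset X Y : Prop :=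
  exists (A : set Y) (f : X -> A), coarse_equivalence f.

Definition uniformly_homeomorphic_to_subset X Y : Prop :=
  exists (A : set Y) (f : X -> A), uniform_homeomorphism f.

End maps.

(* Main.v *)
(* A name is a natural number that codes a finite list of names one scale
   coarser (its "upper" names, the first being its "parent").  A thread picks for
   each scale l in Z a non-empty set of at most n+1 names such that the upper names
   of a chosen name are chosen one scale up, and the parent of a chosen name is an
   upper name of all names chosen with it.  Two threads touch at scale l when they
   share a name there.  If s, t, u, r touch successively at scale l, then s and r
   share, at scale l+1, the parent of any name common to t and u; hence
   "touching at scale l" is, up to a factor 2, "being at distance 2^l" for a
   pseudometric, and the sets of threads through a given name form a cover of mesh
   2^l, Lebesgue number 2^(l-1) and multiplicity n+1.  This gives
   asdim, udim <= n for the space U of all threads (modulo zero distance).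

   Conversely, a sequence of covers of X of multiplicity n+1, each mesh small
   compared with the next Lebesgue number, is encoded by naming the members: the
   upper names of V are those of the parents of the members meeting V.  The
   recursion stops because, in all large enough scales, everything in sight of a
   given point lies in one base member, whose name is 0.  For (a) the covers are
   indexed by the large scales and for (b) by the small ones.

   Encoding R^n in the same way (by stars of Freudenthal triangulations at scales
   c^l) shows that U has no cover of finite mesh, positive Lebesgue number and
   multiplicity n: it would colour the vertices of a fine grid so that no cell
   sees more than n colours while each colour class has bounded size, against
   Sperner's lemma. *)
Require Import Defs.
From HB Require Import structures.
From mathcomp Require Import all_boot all_order all_algebra.
From mathcomp Require Import all_classical all_reals all_analysis.
From mathcomp Require Import zify ring lra.

Set Implicit Arguments.
Unset Strict Implicit.
Unset Printing Implicit Defensive.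

Import Order.TTheory GRing.Theory Num.Theory.
Import numFieldNormedType.Exports.

(** * Sperner's lemma on grids *)

Section chains_mod2.
Variable T : Type.
Implicit Types (c : seq T -> bool) (L : seq (seq T)) (s : seq T).

(** A list of simplices is a chain over F_2 and a Boolean function on simplices a cochain; this is
    their pairing. *)
Definition ev c L : bool := foldr (fun s b => c s (+) b) false L.

Lemma ev_cat c L1 L2 : ev c (L1 ++ L2) = ev c L1 (+) ev c L2.
Proof. by elim: L1 => //= s L ->; rewrite addbA. Qed.

Lemma ev_map c g L : ev c (map g L) = ev (c \o g) L.
Proof. by elim: L => //= s L ->. Qed.

Lemma ev_addb c1 c2 L : ev (fun s => c1 s (+) c2 s) L = ev c1 L (+) ev c2 L.
Proof. by elim: L => //= s L ->; rewrite addbACA. Qed.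

Lemma eq_ev c1 c2 L : c1 =1 c2 -> ev c1 L = ev c2 L.
Proof. by move=> e; elim: L => //= s L ->; rewrite e. Qed.

(** The faces of an ordered simplex. The empty simplex is the face of a vertex, so this is the
    augmented boundary. *)
Fixpoint bd s : seq (seq T) :=
  if s is u :: s' then s' :: map (cons u) (bd s') else [::].

Definition cobd c s : bool := ev c (bd s).

Lemma cobd_cons c u s : cobd c (u :: s) = c s (+) cobd (c \o cons u) s.
Proof. by rewrite /cobd /= ev_map. Qed.

Lemma eq_cobd c1 c2 : c1 =1 c2 -> cobd c1 =1 cobd c2.
Proof. by move=> e s; apply: eq_ev. Qed.

Lemma cobd_addb c1 c2 s :
  cobd (fun s => c1 s (+) c2 s) s = cobd c1 s (+) cobd c2 s.
Proof. exact: ev_addb. Qed.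

End chains_mod2.

(** * The prism operator and its homotopy formula *)

Section prism.
Variables (T U : Type) (bot top : T -> U).
Implicit Types (s : seq T) (c : seq U -> bool).

(** The standard triangulation of simplex times interval: bottom vertices up to some vertex, then
    top vertices from that same vertex on. *)
Fixpoint prism s : seq (seq U) :=
  if s is u :: s' then
    (bot u :: top u :: map top s') :: map (cons (bot u)) (prism s')
  else [::].

Definition coprism c s : bool := ev c (prism s).

Lemma coprism_cons c u s : coprism c (u :: s) =
  c (bot u :: top u :: map top s) (+) coprism (c \o cons (bot u)) s.
Proof. by rewrite /coprism /= ev_map. Qed.

Lemma cobd_map c s : cobd (c \o map top) s = cobd c (map top s).
Proof.
elim: s c => //= u s IH c; rewrite !cobd_cons /=; congr (_ (+) _).
by rewrite -IH; apply: eq_cobd.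
Qed.

(* The homotopy formula for the prism operator, over F_2. *)
Lemma coprism_cobd c s :
  coprism (cobd c) s =
  c (map top s) (+) c (map bot s) (+) cobd (coprism c) s.
Proof.
elim: s c => [|u s IH] c; first by rewrite /coprism /cobd /= addbb.
rewrite coprism_cons !cobd_cons /=.
have -> : coprism (cobd c \o cons (bot u)) s =
    coprism c s (+) coprism (cobd (c \o cons (bot u))) s.
  rewrite /coprism -ev_addb; apply: eq_ev => t /=; exact: cobd_cons.
rewrite IH /=.
have -> : cobd (coprism c \o cons u) s =
    cobd ((c \o cons (bot u) \o cons (top u)) \o map top) s (+)
    cobd (coprism (c \o cons (bot u))) s.
  by rewrite -cobd_addb; apply: eq_cobd => t /=; rewrite coprism_cons.
rewrite cobd_map /=.
move: (c (top u :: map top s)) (c (bot u :: map top s)) (c (bot u :: map bot s)).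
move: (cobd _ (map top s)) (coprism c s) (cobd _ s) => a b d e f g.
by case: a b d e f g => [] [] [] [] [] [].

Qed.

End prism.



Lemma eq_in_ev (T : eqType) (c1 c2 : seq T -> bool) (L : seq (seq T)) :
  {in L, c1 =1 c2} -> ev c1 L = ev c2 L.
Proof.
elim: L => //= s L IH e; rewrite e ?mem_head// IH// => t tL.
by apply: e; rewrite inE tL orbT.
Qed.

Lemma ev_false T (L : seq (seq T)) : ev (fun=> false) L = false.
Proof. by elim: L. Qed.

(** * Counting faces that carry prescribed labels *)

Section doors.
Implicit Types (A l : seq nat).

Definition covers A l := all (mem l) A.

Lemma covers_size A l : uniq A -> size l < size A -> covers A l = false.
Proof.
move=> uA slA; apply/negP => /allP Al.
by have := uniq_leq_size uA Al; rewrite leqNgt slA.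
Qed.

Lemma covers_cons x A l : uniq A -> covers A (x :: l) = covers (rem x A) l.
Proof.
move=> uA; rewrite /covers rem_filter//; elim: A {uA} => //= y A IH.
rewrite inE; case: (eqVneq y x) => //= _; by rewrite IH.
Qed.

Lemma size_bd (T : eqType) (s t : seq T) : t \in bd s -> (size t).+1 = size s.
Proof.
elim: s t => //= u s IH t; rewrite inE => /predU1P[->//|/mapP[r /IH <- ->]//].
Qed.

Lemma cobd_covers0 A l : uniq A -> size l = size A -> cobd (covers A) l = false.
Proof.
move=> uA slA; rewrite -(ev_false (bd l)); apply: eq_in_ev => t /size_bd st.
by rewrite covers_size// -slA -st.
Qed.

(* The parity of the number of "doors" in Sperner's argument. *)
Lemma cobd_covers A l : uniq A -> size l = (size A).+1 ->
  cobd (covers A) l = covers A l && has [predC A] l.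
Proof.
elim: l A => [//|x l IH] A uA /= [sl]; rewrite cobd_cons.
have -> : cobd (covers A \o cons x) l = cobd (covers (rem x A)) l.
  by apply: eq_cobd => t /=; rewrite covers_cons.
rewrite covers_cons//.
have [xA|xA] /= := boolP (x \in A); last first.
  (* Only the face omitting [x] can cover [A]: in the others too few vertices besides [x] remain. *)
  by rewrite rem_id// cobd_covers0// addbF andbT.
have srA : (size (rem x A)).+1 = size A.
  by rewrite size_rem// prednK//; case: (A) xA.
rewrite IH ?rem_uniq// ?srA//.
have memrA y : (y \in rem x A) = (y != x) && (y \in A).
  by rewrite mem_rem_uniq// inE.
have hasE : has [predC rem x A] l = (x \in l) || has [predC A] l.
  elim: (l) => //= y l' ->; rewrite inE memrA negb_and negbK eq_sym.
  by case: (x == y); case: (y \in A); case: (x \in l').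
have covE : covers A l = (x \in l) && covers (rem x A) l.
  rewrite /covers; apply/allP/andP => [Al|[xl /allP rl] y yA].
    split; first exact: Al.
    by apply/allP => y; rewrite memrA => /andP[_ /Al].
  by have [->//|yx] := eqVneq y x; apply: rl; rewrite memrA yx.
rewrite hasE covE; have [cr|] := boolP (covers (rem x A) l); last by rewrite !andbF.
rewrite andbT /=; have [xl|//] := boolP (x \in l).
(* Here [l] covers [A] and has exactly as many entries, so no label outside [A] fits in. *)
rewrite /=; apply/esym/negbTE/hasPn => y yl /=; rewrite negbK.
have cA : {subset A <= l} by apply/allP; move: covE; rewrite xl cr => /=.
have [|_ Al] := uniq_min_size uA cA; first by rewrite sl.
by rewrite Al.
Qed.

End doors.

(** * Parity of rainbow simplices in a triangulated cube *)

Section sperner.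
Variable N : nat.
Implicit Types (u : nat -> nat) (s : seq (nat -> nat)) (c : seq (nat -> nat) -> bool)
  (lam : (nat -> nat) -> nat).

Definition setc k t u : nat -> nat := fun i => if i == k then t else u i.

(** A triangulation of the cube [0, N]^k: each unit slab in the last direction consists of the
    prisms over the triangulated cube of one dimension less. *)
Fixpoint cube_chain k : seq (seq (nat -> nat)) :=
  if k is k'.+1 then
    flatten [seq flatten [seq prism (setc k' t) (setc k' t.+1) s
                         | s <- cube_chain k'] | t <- iota 0 N]
  else [:: [:: fun=> 0]].

Definition slabs c k M :=
  foldr (fun t b => ev (coprism (setc k t) (setc k t.+1) c) (cube_chain k) (+) b)
    false (iota 0 M).

Lemma ev_cube_chainS c k : ev c (cube_chain k.+1) = slabs c k N.
Proof.
rewrite /= /slabs; elim: (iota 0 N) => //= t l IH; rewrite ev_cat IH.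
congr (_ (+) _); by elim: (cube_chain k) => //= s L <-; rewrite ev_cat.
Qed.

Lemma foldr_addb (f g : nat -> bool) (r : seq nat) :
  foldr (fun t b => f t (+) g t (+) b) false r =
  foldr (fun t b => f t (+) b) false r (+) foldr (fun t b => g t (+) b) false r.
Proof. by elim: r => //= t r ->; rewrite addbACA. Qed.

Lemma telescope_addb (f : nat -> bool) M :
  foldr (fun t b => f t.+1 (+) f t (+) b) false (iota 0 M) = f M (+) f 0.
Proof.
elim: M => [|M IH]; first by rewrite addbb.
rewrite -addn1 iotaD foldr_cat /= add0n addn1 addbF.
have aux b r : foldr (fun t b => f t.+1 (+) f t (+) b) b r =
    foldr (fun t b => f t.+1 (+) f t (+) b) false r (+) b.
  by elim: r => //= t r ->; rewrite addbA.
by rewrite aux IH; case: (f M.+1) (f M) (f 0) => [] [] [].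
Qed.

Lemma eq_foldr_addb (f g : nat -> bool) r : f =1 g ->
  foldr (fun t b => f t (+) b) false r = foldr (fun t b => g t (+) b) false r.
Proof. by move=> fg; elim: r => //= t r ->; rewrite fg. Qed.

(** Stokes' formula: by the homotopy formula, the horizontal faces of consecutive slabs cancel,
    which leaves the two extreme ones and the vertical sides. *)
Lemma ev_cube_chain_cobd c k : ev (cobd c) (cube_chain k.+1) =
  ev (c \o map (setc k N)) (cube_chain k) (+)
  ev (c \o map (setc k 0)) (cube_chain k) (+)
  foldr (fun t b => ev (cobd (coprism (setc k t) (setc k t.+1) c)) (cube_chain k) (+) b)
    false (iota 0 N).
Proof.
rewrite ev_cube_chainS /slabs -(telescope_addb (fun t => ev (c \o map (setc k t)) (cube_chain k))).
rewrite -foldr_addb; apply: eq_foldr_addb => t.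
rewrite -!ev_addb; apply: eq_ev => s; exact: coprism_cobd.
Qed.


Lemma coprism0 (P : pred (nat -> nat)) c k t s :
    (forall u j, P u -> P (setc k j u)) ->
    (forall r, all P r -> c r = false) -> all P s ->
  coprism (setc k t) (setc k t.+1) c s = false.
Proof.
move=> Pset; elim: s c => //= u s IH c c0 /andP[Pu Ps].
rewrite coprism_cons c0 /=; last first.
  rewrite !Pset//= all_map; apply: sub_all Ps => v; exact: Pset.
by apply: IH => // r Pr /=; rewrite c0//= Pset.
Qed.

(** The boundary of the cube lies in its faces, where [c] vanishes. The condition on the empty
    simplex serves dimension 0, where the boundary of the single vertex is that simplex. *)
Lemma ev_cobd_face c k : c [::] = false ->
    (forall i M s, i < k -> M \in [:: 0; N] -> all (fun u => u i == M) s ->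
      c s = false) ->
  ev (cobd c) (cube_chain k) = false.
Proof.
elim: k c => [|k IH] c c_nil c0; first by rewrite /= /cobd /= c_nil.
rewrite ev_cube_chain_cobd.
have side M : M \in [:: 0; N] -> ev (c \o map (setc k M)) (cube_chain k) = false.
  move=> MN; rewrite -(ev_false (cube_chain k)); apply: eq_ev => s /=.
  by apply: (c0 k M) => //; rewrite all_map; elim: s => //= u r ->; rewrite /setc !eqxx.
rewrite !side ?inE ?eqxx ?orbT// !addFb.
elim: (iota 0 N) => //= t r ->; rewrite addbF; apply: IH => // i M s ik MN.
apply: (@coprism0 (fun u => u i == M)) => [u j|r' rP].
  by rewrite /= /setc (ltn_eqF ik).
by apply: (c0 i M) => //; exact: ltnW.
Qed.

Lemma all_prism (P : pred (nat -> nat)) (Q : pred (nat -> nat)) k t s :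
  (forall u, P u -> Q (setc k t u) && Q (setc k t.+1 u)) -> all P s ->
  all (all Q) (prism (setc k t) (setc k t.+1) s).
Proof.
move=> PQ; elim: s => //= u s IH /andP[/PQ /andP[Q1 Q2] Ps].
rewrite Q1 Q2 /= all_map; apply/andP; split.
  by apply: sub_all Ps => v /PQ /andP[].
rewrite all_map; apply: sub_all (IH Ps) => r /= ->; by rewrite Q1.
Qed.

Definition near_pt m (u v : nat -> nat) :=
  all (fun i => (u i <= (v i).+1) && (v i <= (u i).+1)) (iota 0 m).

Lemma near_pt_refl m u : near_pt m u u.
Proof. by apply/allP => i _; rewrite leqnSn. Qed.

Lemma near_pt_setc m k t a b u v : near_pt m u v -> a <= t.+1 -> t <= a ->
  b <= t.+1 -> t <= b -> near_pt m (setc k a u) (setc k b v).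
Proof.
move=> uv *; apply: sub_all uv => i; rewrite /setc; case: eqP => // _ _.
by apply/andP; split; [apply: (@leq_trans t.+1)|apply: (@leq_trans t.+1)].
Qed.

Lemma pairwise_prism m k t s : pairwise (near_pt m) s ->
  all (pairwise (near_pt m)) (prism (setc k t) (setc k t.+1) s).
Proof.
elim: s => //= u s IH /andP[us ps].
rewrite (@near_pt_setc m k t) ?near_pt_refl//= !all_map pairwise_map.
have usS j : t <= j <= t.+1 -> all (fun v => near_pt m (setc k j u) (setc k t.+1 v)) s.
  by move=> /andP[tj jt]; apply: sub_all us => v uv; exact: (@near_pt_setc m k t).
rewrite !usS ?leqnn ?leqnSn//=; apply/andP; split.
  by apply: sub_pairwise ps => v w vw; exact: (@near_pt_setc m k t).
have : all (all (near_pt m (setc k t u))) (prism (setc k t) (setc k t.+1) s).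
  by apply: all_prism us => v uv; rewrite !(@near_pt_setc m k t).
move: (IH ps); elim: (prism _ _ _) => //= r L IHL /andP[-> /IHL aL] /andP[-> /aL].
by [].
Qed.

Lemma size_prism k t s : all (fun r => size r == (size s).+1)
  (prism (setc k t) (setc k t.+1) s).
Proof.
by elim: s => //= u s IH; rewrite size_map eqxx /= all_map.
Qed.

Lemma cube_chain_cell m k :
  all (fun s => (size s == k.+1) && pairwise (near_pt m) s) (cube_chain k).
Proof.
elim: k => //= k IH; elim: (iota 0 N) => //= t r IHr; rewrite all_cat IHr andbT.
elim: (cube_chain k) IH => //= s L IHL /andP[/andP[/eqP ss ps] /IHL aL].
rewrite all_cat aL andbT; have := size_prism k t s; have := pairwise_prism k t ps.
by rewrite ss; elim: (prism _ _ _) => //= a b IHb /andP[-> /IHb h] /andP[-> /h].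
Qed.

Lemma ev_all (P : pred (seq (nat -> nat))) c1 c2 L :
  (forall s, P s -> c1 s = c2 s) -> all P L -> ev c1 L = ev c2 L.
Proof. by move=> e; elim: L => //= s L IH /andP[/e -> /IH ->]. Qed.

Lemma ev_exists c L P : ev c L -> all P L -> exists s, P s && c s.
Proof.
elim: L => //= s L IH; have [cs _ /andP[Ps _]|_] := boolP (c s).
  by exists s; rewrite Ps.
by move=> /IH h /andP[_ /h].
Qed.

Definition rainbow lam k s := covers (iota 0 k) (map lam s).

Lemma rainbow_missing lam k j s : j < k -> all (fun u => lam u != j) s ->
  rainbow lam k s = false.
Proof.
move=> jk sj; apply/negP => /allP/(_ j); rewrite mem_iota /= add0n => /(_ jk).
elim: s sj => //= u s IH /andP[uj /IH js]; rewrite inE => /orP[/eqP uE|//].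
by rewrite uE eqxx in uj.
Qed.

(** The number of rainbow simplices is odd, by induction on the dimension. By Stokes' formula it has
    the parity of the doors, labelled 0 to k, on the boundary of the (k+1)-cube. Only the face where
    coordinate k is 0 has any: it carries labels at most k and falls under induction, while every
    other face misses a label. *)
Lemma ev_rainbow k lam : (forall u, lam u <= k) ->
    (forall u i, i < k -> u i = 0 -> lam u <= i) ->
    (forall u i, i < k -> u i = N -> lam u != i) ->
  ev (rainbow lam k.+1) (cube_chain k).
Proof.
elim: k lam => [|k IH] lam lamk lam0 lamN.
  by rewrite /= addbF /rainbow /= inE andbT eq_sym -leqn0.
(* The only label outside 0..k is k+1, so by [cobd_covers] being rainbow is the coboundary of being
   a door. *)
have -> : ev (rainbow lam k.+2) (cube_chain k.+1) =
          ev (cobd (rainbow lam k.+1)) (cube_chain k.+1).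
  apply: ev_all (cube_chain_cell 0 k.+1) => s /andP[/eqP ss _].
  rewrite -[cobd _ s]/(cobd (covers (iota 0 k.+1) \o map lam) s) cobd_map.
  rewrite cobd_covers ?iota_uniq ?size_map ?size_iota//.
  rewrite /rainbow /covers -[k.+2]addn1 iotaD all_cat /= add0n andbT.
  congr (_ && _); elim: s {ss} => //= u s <-; rewrite inE; congr (_ || _).
  rewrite -[_ :: _]/(iota 0 k.+1) mem_iota /= add0n -leqNgt.
  by rewrite eqn_leq lamk andbT.
rewrite ev_cube_chain_cobd.
have -> : ev (rainbow lam k.+1 \o map (setc k N)) (cube_chain k) = false.
  rewrite -(ev_false (cube_chain k)); apply: eq_ev => s /=.
  apply: (@rainbow_missing _ _ k) => //; rewrite all_map; elim: s => //= u s ->.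
  by rewrite andbT lamN// /setc eqxx.
have -> : ev (rainbow lam k.+1 \o map (setc k 0)) (cube_chain k) = true.
  pose lam' u := lam (setc k 0 u).
  rewrite -[RHS](IH lam'); last 3 first.
  - by move=> u; apply: lam0; rewrite // /setc eqxx.
  - move=> u i ik ui; apply: lam0; first exact: ltnW.
    by rewrite /setc ui if_same.
  - move=> u i ik ui; apply: lamN; first exact: ltnW.
    by rewrite /setc ltn_eqF.
  by apply: eq_ev => s; rewrite /= /rainbow -map_comp.
suff -> : foldr (fun t b => ev (cobd (coprism (setc k t) (setc k t.+1)
    (rainbow lam k.+1))) (cube_chain k) (+) b) false (iota 0 N) = false by [].
elim: (iota 0 N) => //= t r ->; rewrite addbF; apply: ev_cobd_face => //.
move=> i M s ik; rewrite !inE => MN.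
apply: (@coprism0 (fun u => u i == M)) => [u j|r' rM]; first by rewrite /= /setc (ltn_eqF ik).
case/orP: MN rM => /eqP-> rM.
  apply: (@rainbow_missing _ _ k) => //; apply: sub_all rM => u /eqP ui.
  by rewrite ltn_eqF// (leq_ltn_trans (lam0 _ _ _ ui))// ltnW.
apply: (@rainbow_missing _ _ i); first exact: ltnW.
by apply: sub_all rM => u /eqP ui; apply: lamN => //; exact: ltnW.
Qed.

(* Kuhn's cubical form of Sperner's lemma. *)
Lemma sperner n lam : (forall u, lam u <= n) ->
    (forall u i, i < n -> u i = 0 -> lam u <= i) ->
    (forall u i, i < n -> u i = N -> lam u != i) ->
  exists u0, forall j, j <= n -> exists2 u, near_pt n u0 u & lam u = j.
Proof.
move=> h1 h2 h3.
have [[|u0 s] /andP[/andP[//]]] :=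
  ev_exists (ev_rainbow h1 h2 h3) (cube_chain_cell n n).
move=> _ /= /andP[s0 _] /allP cov; exists u0 => j jn.
have := cov j; rewrite mem_iota /= add0n ltnS => /(_ jn).
rewrite inE => /orP[/eqP ->|]; first by exists u0 => //; exact: near_pt_refl.
elim: s s0 {cov} => //= u s IH /andP[u0u /IH h]; rewrite inE => /orP[/eqP ->|/h//].
by exists u.
Qed.

End sperner.

Local Open Scope classical_set_scope.
Local Open Scope ring_scope.

(** * The universal space *)

Section names.

Definition mkname (i : nat) (l : seq nat) : nat := CodeSeq.code (i :: l).

(** The number 0 codes the empty list; it is the base name, and its only upper name is itself. *)
Definition upper (v : nat) : seq nat :=
  if CodeSeq.decode v is _ :: l then l else [:: 0%N].

Definition parent (v : nat) : nat := head 0%N (upper v).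

Lemma upper_mkname i l : upper (mkname i l) = l.
Proof. by rewrite /upper /mkname CodeSeq.codeK. Qed.

Lemma mkname_inj i j l1 l2 : mkname i l1 = mkname j l2 -> i = j.
Proof. by move=> /(can_inj CodeSeq.codeK) []. Qed.

Lemma mkname_neq0 i l : mkname i l <> 0%N.
Proof. by rewrite -[0%N]/(CodeSeq.code [::]) => /(can_inj CodeSeq.codeK). Qed.

End names.

Section threads.
Variable n : nat.

(** The last clause makes any two threads touch at some scale, since the base name persists at all
    coarser scales; hence distances are finite. *)
Definition thread_axiom (s : int -> seq nat) : Prop :=
  (forall l, [/\ s l != [::], (size (s l) <= n.+1)%N,
     {in s l &, forall v w, parent v \in upper w} &
     {in s l, forall v, {subset upper v <= s (l + 1)}}]) /\
  exists l, 0%N \in s l.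

Record thread := Thread { level :> int -> seq nat; threadP : thread_axiom level }.

HB.instance Definition _ := gen_eqMixin thread.
HB.instance Definition _ := gen_choiceMixin thread.

Lemma thread0_subproof : thread_axiom (fun=> [:: 0%N]).
Proof.
split; last by exists 0.
move=> l; split => // [v w|v]; rewrite !inE => /eqP->//.
by move=> /eqP ->.
Qed.

Definition thread0 := Thread thread0_subproof.

Implicit Types s t u : thread.

Definition touch l s t : bool := has (mem (s l)) (t l).

Lemma touchP l s t :
  reflect (exists2 v, v \in s l & v \in t l) (touch l s t).
Proof. by apply: (iffP hasP) => -[v]; exists v. Qed.

Lemma touchxx l s : touch l s s.
Proof.
have [/(_ l) [sl _ _ _] _] := threadP s; apply/touchP.
by case: (level s l) sl => // v r _; exists v; rewrite mem_head.
Qed.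

Lemma touch_sym l s t : touch l s t = touch l t s.
Proof. by apply/touchP/touchP => -[v]; exists v. Qed.

Lemma parent_level l s v w : v \in s l -> w \in s l -> parent v \in upper w.
Proof. by have [/(_ l) [_ _ + _] _] := threadP s; exact. Qed.

Lemma upper_level l s v w : v \in s l -> w \in upper v -> w \in s (l + 1).
Proof. by have [/(_ l) [_ _ _ h] _ vs] := threadP s; exact: h. Qed.

Lemma touch3 l s t u r :
  touch l s t -> touch l t u -> touch l u r -> touch (l + 1) s r.
Proof.
move=> /touchP[v vs vt] /touchP[w wt wu] /touchP[z zu zr]; apply/touchP.
exists (parent w).
  by apply: (upper_level vs); apply: parent_level wt vt.
by apply: (upper_level zr); apply: parent_level wu zu.
Qed.

Lemma touch_le l l' s t : l <= l' -> touch l s t -> touch l' s t.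
Proof.
move=> ll' st; have [k ->] : exists k : nat, l' = l + k%:Z.
  by exists `|l' - l|%N; lia.
elim: k => [|k IH]; first by rewrite addr0.
have -> : l + k.+1%:Z = l + k%:Z + 1 by lia.
by apply: (touch3 IH); exact: touchxx.
Qed.

Lemma base_le l l' s : l <= l' -> 0%N \in s l -> 0%N \in s l'.
Proof.
move=> ll' st; have [k ->] : exists k : nat, l' = l + k%:Z.
  by exists `|l' - l|%N; lia.
elim: k => [|k IH]; first by rewrite addr0.
have -> : l + k.+1%:Z = l + k%:Z + 1 by lia.
by apply: (upper_level IH).
Qed.

Lemma touch_exists s t : exists l, touch l s t.
Proof.
have [_ [l1 s1]] := threadP s; have [_ [l2 s2]] := threadP t.
exists (Num.max l1 l2); apply/touchP; exists 0%N.
  by apply: base_le s1; rewrite le_max lexx.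
by apply: base_le s2; rewrite le_max lexx orbT.
Qed.

End threads.

(** * The chain pseudometric on threads *)

Section thread_distance.
Variables (R : realType) (n : nat).
Implicit Types (s t u : thread n) (c : seq (int * thread n)) (l : int).

Lemma pow2_gt0 l : 0 < 2 ^ l :> R.
Proof. exact: exprz_gt0. Qed.

Lemma pow2S l : 2 ^ (l + 1) = 2 ^ l + 2 ^ l :> R.
Proof. by rewrite expfzDr// expr1z mulrDr mulr1. Qed.

Lemma ltr_pow2 l l' : ((2 : R) ^ l < 2 ^ l') = (l < l').
Proof. by apply: ltr_eXz2l; rewrite ltr1n. Qed.

Lemma pow2_large (x : R) : exists l, x < 2 ^ l.
Proof.
by exists (Num.bound x)%:Z; exact: upper_nthrootP.
Qed.

Lemma pow2_small (x : R) : 0 < x -> exists l, 2 ^ l < x.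
Proof.
move=> x0; have [l xl] := pow2_large x^-1; exists (- l).
by rewrite -invr_expz invf_plt ?posrE// pow2_gt0.
Qed.

(** A chain is a list of steps [(l, u)]: pass to [u], touched at scale [l], at the cost of 2 ^ l. *)
Fixpoint links s c : bool :=
  if c is x :: c' then touch x.1 s x.2 && links x.2 c' else true.

Definition target s c := last s (map snd c).

Definition cost c : R := \sum_(x <- c) 2 ^ x.1.

Lemma cost_ge0 c : 0 <= cost c.
Proof. by apply: sumr_ge0 => x _; exact/ltW/pow2_gt0. Qed.

Lemma cost_cons x c : cost (x :: c) = 2 ^ x.1 + cost c.
Proof. exact: big_cons. Qed.

Lemma cost_cat c1 c2 : cost (c1 ++ c2) = cost c1 + cost c2.
Proof. exact: big_cat. Qed.

Lemma links_cat s c1 c2 :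
  links s (c1 ++ c2) = links s c1 && links (target s c1) c2.
Proof. by elim: c1 s => //= x c1 IH s; rewrite IH andbA. Qed.

Lemma target_cat s c1 c2 : target s (c1 ++ c2) = target (target s c1) c2.
Proof. by rewrite /target map_cat last_cat. Qed.

Lemma links_rev s c : links s c ->
  exists2 c', links (target s c) c' &
    target (target s c) c' = s /\ cost c' = cost c.
Proof.
elim: c s => [|[l u] c IH] s /=; first by exists [::].
move=> /andP[su /IH[c' lc' [tc' cc']]]; exists (c' ++ [:: (l, s)]).
  rewrite links_cat -/(target u c) lc' /= tc' touch_sym su //.
by rewrite target_cat cost_cat !cost_cons cc' addrC /cost !big_nil addr0.
Qed.

Lemma cost_split (a : R) c : c != [::] -> 0 < a ->
  exists c1 x c2, [/\ c = c1 ++ x :: c2, cost c1 < a &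
    c2 = [::] \/ a <= cost c1 + 2 ^ x.1].
Proof.
elim: c a => // x c IH a _ a0; have [xa|xa] := leP a (2 ^ x.1).
  by exists [::], x, c; rewrite /cost big_nil add0r; split => //; right.
have [->|c0] := eqVneq c [::].
  by exists [::], x, [::]; rewrite /cost big_nil; split => //; left.
have [|c1 [y [c2 [-> c1a yc]]]] := IH (a - 2 ^ x.1) c0; first by rewrite subr_gt0.
exists (x :: c1), y, c2; rewrite cost_cons; split => //; first by lra.
by case: yc; [left|right; lra].
Qed.

(* The argument of the metrization lemma for uniformities: cut the chain where
   half of [2 ^ l] is exceeded, and use [touch3]. *)
Lemma touch_cost l s c : links s c -> cost c < 2 ^ l -> touch l s (target s c).
Proof.
have [m] := ubnP (size c); elim: m l s c => // m IH l s c sc lc cl.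
have [->|c0] := eqVneq c [::]; first exact: touchxx.
have lE : l = l - 1 + 1 by rewrite subrK.
have powE : (2 : R) ^ l = 2 ^ (l - 1) + 2 ^ (l - 1) by rewrite {1}lE pow2S.
have [c1 [[k u] [c2 [cE c1l]]]] := cost_split c0 (pow2_gt0 (l - 1)).
move: sc lc cl; rewrite cE size_cat links_cat target_cat cost_cat cost_cons /=.
rewrite -/(target u c2) => sc /and3P[lc1 ku lc2] cl c2l.
have /andP[sc1 sc2] : (size c1 < m)%N && (size c2 < m)%N by clear -sc; lia.
have c10 := cost_ge0 c1; have c20 := cost_ge0 c2.
(* The parts before and after the crossing step each cost less than 2 ^ (l - 1) or are empty, and
   that step has scale below [l]; so all three give touching at scale l - 1. *)
rewrite lE; apply: (@touch3 _ _ _ (target s c1) u).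
- exact: IH.
- apply: touch_le ku; rewrite -ltzD1 subrK -ltr_pow2.
  by move: cl c10 c20 powE; clear; lra.
- case: c2l => [->|c2l]; first exact: touchxx.
  by apply: IH => //; move: cl c2l powE; clear; lra.
Qed.

Definition tdist s t : R :=
  inf [set cost c | c in [set c | links s c /\ target s c = t]].

Let costs s t := [set cost c | c in [set c | links s c /\ target s c = t]].

Let costs_lb s t : lbound (costs s t) 0.
Proof. by move=> _ [c _ <-]; exact: cost_ge0. Qed.

Let costs_touch l s t : touch l s t -> costs s t (2 ^ l).
Proof.
move=> st; exists [:: (l, t)]; first by rewrite /= st.
by rewrite cost_cons /cost big_nil addr0.
Qed.

Let costs_nonempty s t : costs s t !=set0.
Proof. by have [l /costs_touch st] := touch_exists s t; exists (2 ^ l). Qed.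

Lemma tdist_ge0 s t : 0 <= tdist s t.
Proof. exact: lb_le_inf (costs_nonempty s t) (costs_lb (t := t)). Qed.

Let tdist_le s t x : costs s t x -> tdist s t <= x.
Proof. by apply: ge_inf; exists 0; exact: costs_lb. Qed.

Lemma tdist_touch l s t : touch l s t -> tdist s t <= 2 ^ l.
Proof. by move=> /costs_touch /tdist_le. Qed.

(** With [tdist_touch], this places touching at scale [l] between distance below 2 ^ l and distance
    at most 2 ^ l. *)
Lemma touch_tdist l s t : tdist s t < 2 ^ l -> touch l s t.
Proof.
by move=> /(inf_lt (costs_nonempty s t)) [_ [c [lc <-] <-]] /touch_cost; exact.
Qed.

Lemma tdistxx s : tdist s s = 0.
Proof.
apply/eqP; rewrite eq_le tdist_ge0 andbT; apply: tdist_le.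
by exists [::] => //; rewrite /cost big_nil.
Qed.

Lemma tdist_sym s t : tdist s t = tdist t s.
Proof.
suff le s' t' : tdist s' t' <= tdist t' s' by apply/eqP; rewrite eq_le !le.
apply: lb_le_inf; first exact: costs_nonempty.
move=> _ [c [/links_rev [c' + [+ <-]] tc] <-]; rewrite tc => lc' tc'.
by apply: tdist_le; exists c'.
Qed.

Lemma tdist_triangle t s u : tdist s u <= tdist s t + tdist t u.
Proof.
rewrite -lerBlDr; apply: lb_le_inf; first exact: costs_nonempty.
move=> _ [c1 [lc1 tc1] <-]; rewrite lerBlDl -lerBlDr.
apply: lb_le_inf; first exact: costs_nonempty.
move=> _ [c2 [lc2 tc2] <-]; rewrite lerBlDr addrC -cost_cat; apply: tdist_le.
by exists (c1 ++ c2) => //=; rewrite links_cat target_cat tc1 lc1.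
Qed.

End thread_distance.

Section diameters.
Context {R : realType} {X : metricType R}.
Implicit Types (A : set X) (U : set (set X)).

Lemma diam_le A (r : R) : 0 <= r ->
  (forall x y, A x -> A y -> mdist x y <= r) -> (diam A <= r%:E)%E.
Proof.
move=> r0 Ar; apply: ge_ereal_sup => _ [->|[[x y] [/= Ax Ay] <-]].
  by rewrite lee_fin.
by rewrite lee_fin Ar.
Qed.

Lemma mdist_le_diam A x y : A x -> A y -> ((mdist x y)%:E <= diam A)%E.
Proof. by move=> Ax Ay; apply: ereal_sup_ubound; right; exists (x, y). Qed.

Lemma mesh_le U (r : R) : 0 <= r ->
  (forall V, U V -> (diam V <= r%:E)%E) -> (mesh U <= r%:E)%E.
Proof.
move=> r0 Ur; apply: ge_ereal_sup => _ [->|[V UV <-]]; last exact: Ur.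
by rewrite lee_fin.
Qed.

Lemma mdist_le_mesh U V x y : U V -> V x -> V y -> ((mdist x y)%:E <= mesh U)%E.
Proof.
move=> UV Vx Vy; apply: le_trans (mdist_le_diam Vx Vy) _.
by apply: ereal_sup_ubound; right; exists V.
Qed.

Lemma open_mball (x : X) (r : R) : open [set y | mdist x y < r].
Proof.
rewrite openE => y /= xy; apply/metricType_numDomainType.nbhs_mdistP; exists (r - mdist x y).
  by rewrite /= subr_gt0.
move=> z /= yz; apply: le_lt_trans (metric_triangle x y z) _.
by rewrite -ltrBrDl.
Qed.

End diameters.

(** * Identification of threads at distance zero *)

Section universal_space.
Variables (R : realType) (n : nat).
Implicit Types (s t u : thread n).

Definition indist s t : Prop := forall l, touch l s t.

Lemma indist_sym s t : indist s t -> indist t s.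
Proof. by move=> st l; rewrite touch_sym. Qed.

Lemma indist_trans t s u : indist s t -> indist t u -> indist s u.
Proof.
move=> st tu l; rewrite -[l](subrK 1); apply: touch3 (st _) (tu _) _.
exact: touchxx.
Qed.

Lemma indist_tdist0 s t : indist s t <-> tdist R s t = 0.
Proof.
split => [st|st l]; last by apply: (@touch_tdist R); rewrite st pow2_gt0.
apply/eqP; rewrite eq_le tdist_ge0 andbT leNgt; apply/negP => /pow2_small[l].
by rewrite ltNge => /negP; apply; exact: tdist_touch.
Qed.

(** The choice depends only on the class of [s] as a set, so indistinguishable threads get the same
    representative. *)
Definition rep s : thread n := xget (thread0 n) (indist s).

Lemma indist_rep s : indist s (rep s).
Proof. by apply: xgetPex; exists s => l; exact: touchxx. Qed.

Lemma rep_indist s t : indist s t -> rep s = rep t.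
Proof.
move=> st; rewrite /rep; congr xget; apply/seteqP; split => u.
  by apply: indist_trans; exact: indist_sym.
exact: indist_trans.
Qed.

Lemma rep_rep s : rep (rep s) = rep s.
Proof. by apply/esym/rep_indist; exact: indist_rep. Qed.

End universal_space.

(* The points are threads modulo zero distance, represented by chosen
   representatives; [R] only serves to make the metric inferable. *)
Definition universal (R : realType) (n : nat) := {s : thread n | rep s == s}.

HB.instance Definition _ R n := Choice.copy (universal R n) {s : thread n | rep s == s}.

Section universal_metric.
Variables (R : realType) (n : nat).
Implicit Types (x y : universal R n).

Let dist x y : R := tdist R (val x) (val y).

Let distxx x : dist x x = 0. Proof. exact: tdistxx. Qed.

Let dist_eq x y : dist x y = 0 -> x = y.
Proof.
move=> /indist_tdist0/rep_indist; case: x y => [s sP] [t tP] /= st.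
by apply: val_inj; rewrite /= -(eqP sP) -(eqP tP).
Qed.

Let dist_sym x y : dist x y = dist y x. Proof. exact: tdist_sym. Qed.

Let dist_triangle y x z : dist x z <= dist x y + dist y z.
Proof. exact: tdist_triangle. Qed.

HB.instance Definition _ := isMetric.Build R (universal R n)
  distxx dist_eq dist_sym dist_triangle.

End universal_metric.

(** * Separability and upper bounds for the dimensions *)

Section universal_theory.
Variables (R : realType) (n : nat).
Local Notation U := (universal R n).
Implicit Types (x y : U).

Definition of_thread (s : thread n) : U :=
  exist _ (rep s) (introT eqP (rep_rep s)).

Lemma mdistE x y : mdist x y = tdist R (val x) (val y).
Proof. by []. Qed.

Lemma mdist_of_thread s t : mdist (of_thread s) (of_thread t) = tdist R s t.
Proof.
have s0 := proj1 (indist_tdist0 R _ _) (indist_rep s).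
have t0 := proj1 (indist_tdist0 R _ _) (indist_rep t).
rewrite mdistE /=; apply/eqP; rewrite eq_le.
have := tdist_triangle R s (rep s) (rep t); have := tdist_triangle R t s (rep t).
have := tdist_triangle R (rep s) s t; have := tdist_triangle R (rep t) (rep s) t.
rewrite (tdist_sym R (rep s) s) (tdist_sym R (rep t) t) s0 t0.
by move: (tdist _ _ _) (tdist _ _ _) (tdist _ _ _) (tdist _ _ _) => a b c d; lra.
Qed.

(** There are countably many pairs of a scale and a name. One point chosen for each pair gives a
    dense set, because points sharing a name at scale [l] are within 2 ^ l. *)
Lemma separable_universal : separable U.
Proof.
pose g (z : int * nat) := xget (of_thread (thread0 n)) [set x : U | z.2 \in val x z.1].
exists (range g); first exact: card_le_trans (card_image_le g setT) (countableP _).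
move=> O [x Ox] Oo; move: (Oo); rewrite openE => /(_ x Ox).
move=> /metricType_numDomainType.nbhs_mdistP[e /= e0 eO].
have [l le] := pow2_small e0; have /touchP[v vx _] := touchxx l (val x).
exists (g (l, v)); split; last by exists (l, v).
apply: eO => /=; apply: le_lt_trans le; apply: tdist_touch; apply/touchP.
exists v => //; rewrite /g.
by have := @xgetPex _ (of_thread (thread0 n)) [set x : U | v \in val x l]; apply; exists x.
Qed.

(** Interiors are taken to get open members; they still cover, with a Lebesgue number, because of
    the balls in [mball_sub_names]. *)
Definition names_cover (l : int) : set (set U) :=
  range (fun v : nat => interior [set x : U | v \in val x l]).

Lemma mball_sub_names (l : int) x : exists v,
  [set y | mdist x y < 2 ^ (l - 1)] `<=` interior [set y : U | v \in val y l].
Proof.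
have /touchP[v vx _] := touchxx (l - 1) (val x); exists (parent v).
rewrite -open_subsetE; last exact: open_mball.
move=> y /= /touch_tdist /touchP[w wx wy]; rewrite -[l](subrK 1).
by apply: (upper_level wy); apply: parent_level vx wx.
Qed.

Lemma open_names_cover l : open_cover (names_cover l).
Proof.
split; first by move=> _ [v _ <-]; exact: open_interior.
apply/seteqP; split => // x _; have [v xv] := mball_sub_names l x.
exists (interior [set y : U | v \in val y l]); first by exists v.
by apply: xv; rewrite /= mdistxx pow2_gt0.
Qed.

Lemma lebesgue_names_cover l : lebesgue_number (names_cover l) (2 ^ (l - 1)).
Proof.
split; first exact: pow2_gt0.
move=> A Al; have [->|/set0P[x Ax]] := eqVneq A set0.
  by exists (interior [set y : U | 0%N \in val y l]) => //; exists 0%N.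
have [v xv] := mball_sub_names l x.
exists (interior [set y : U | v \in val y l]); first by exists v.
move=> y Ay; apply: xv; rewrite /= -lte_fin; apply: le_lt_trans Al.
exact: mdist_le_diam.
Qed.

Lemma mesh_names_cover l : (mesh (names_cover l) <= (2 ^ l : R)%:E)%E.
Proof.
apply: mesh_le => [|_ [v _ <-]]; first exact/ltW/pow2_gt0.
apply: diam_le => [|x y /interior_subset xv /interior_subset yv].
  exact/ltW/pow2_gt0.
by apply: tdist_touch; apply/touchP; exists v.
Qed.

Lemma multiplicity_names_cover l : multiplicity_le (names_cover l) (n%:Z + 1).
Proof.
move=> k F Fl Fk [x xF]; have [/(_ l)[_ sn _ _] _] := threadP (val x).
suff : (`I_k #<= `I_(size (val x l)))%card.
  by rewrite card_le_II => kn; have := leq_trans kn sn; lia.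
rewrite -(card_le_eql Fk).
(* Every member through [x] comes from one of the at most n+1 names of [x] at scale [l]. *)
pose g i := interior [set y : U | nth 0%N (val x l) i \in val y l].
apply: card_le_trans (card_image_le g _); apply: subset_card_le => V FV.
have [v _ vV] := Fl V FV.
have /interior_subset /= vx : interior [set y : U | v \in val y l] x.
  by rewrite vV; exact: xF.
by exists (index v (val x l)); rewrite /= ?index_mem// /g nth_index.
Qed.

Lemma udim_universal : udim_le U n%:Z.
Proof.
move=> r r0; have [l lr] := pow2_small r0; exists (names_cover l); split.
- exact: open_names_cover.
- by apply: le_lt_trans (mesh_names_cover l) _; rewrite lte_fin.
- by exists (2 ^ (l - 1)); exact: lebesgue_names_cover.
- exact: multiplicity_names_cover.
Qed.

Lemma asdim_universal : asdim_le U n%:Z.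
Proof.
move=> r; have [l lr] := pow2_large r; exists (names_cover (l + 1)); split.
- exact: open_names_cover.
- by exists (2 ^ l) => //; have := @lebesgue_names_cover (l + 1); rewrite addrK.
- exact: le_lt_trans (mesh_names_cover _) (ltry _).
- exact: multiplicity_names_cover.
Qed.

End universal_theory.

(** * Embedding spaces with graded covers *)

Section embedding.
Context {R : realType} {X : Type} {n : nat}.
Variables (delta : X -> X -> R) (x0 : X) (C : int -> nat -> set X) (m : int -> R).
Hypotheses (deltaxx : forall x, delta x x = 0)

  (delta_tri : forall x y z, delta x z <= delta x y + delta y z).
Hypotheses (m_ge0 : forall l, 0 <= m l)
  (C_mesh : forall l i x y, C l i x -> C l i y -> delta x y <= m l)
  (C_lebesgue : forall l x, exists i,
    [set y | delta x y <= 10 * m l] `<=` C (l + 1) i)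
  (C_multiplicity : forall l x, exists2 s : seq nat,
    (size s <= n.+1)%N & forall i, (i \in s) <-> C l i x)
  (m_exhaust : forall x, exists l, delta x0 x <= m l).
Implicit Types (l : int) (i j k f : nat) (x y : X).

Let meet l i j := exists2 x, C l i x & C l j x.

Let base_ex l : exists i, [set y | delta x0 y <= 10 * m (l - 1)] `<=` C l i.
Proof. by have := C_lebesgue (l - 1) x0; rewrite subrK. Qed.

Let base l : nat := sval (cid (base_ex l)).

Let base_sub l y : delta x0 y <= 10 * m l -> C (l + 1) (base (l + 1)) y.
Proof. by rewrite /base; case: cid => /= i; rewrite addrK; exact. Qed.

Let base_x0 l : C l (base l) x0.
Proof.
rewrite -[l](subrK 1); apply: base_sub.
by rewrite deltaxx mulr_ge0.
Qed.

(** Two meetings are allowed so that every member meeting a neighbour of the base gets the base as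
    parent; such a neighbour then has no other upper index. *)
Let near_base l i := exists2 j, meet l i j & meet l j (base l).

(** A member meeting [i] stays within 2 * m l of any point of [i], and within 4 * m l of [x0] when
    [i] is near the base. Both radii are below 10 * m l, so a single member one scale up contains
    all of these. *)
Let parent_ex l i : exists k,
  (forall j, meet l i j -> C l j `<=` C (l + 1) k) /\
  (near_base l i -> k = base (l + 1)).
Proof.
have [[j0 [x ix jx] [y jy By]]|nbi] := pselect (near_base l i).
  exists (base (l + 1)); split => // j [z iz jz] w jw; apply: base_sub.
  have d1 := C_mesh (base_x0 l) By; have d2 := C_mesh jy jx.
  have d3 := C_mesh ix iz; have d4 := C_mesh jz jw.
  have := delta_tri x0 y w; have := delta_tri y x w; have := delta_tri x z w.
  by have := m_ge0 l; lra.
have [[x ix]|ni] := pselect (exists x, C l i x); last first.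
  by exists 0%N; split => // j [x ix _]; case: ni; exists x.
have [k xk] := C_lebesgue l x; exists k; split => // j [y iy jy] z jz.
apply: xk => /=; have := delta_tri x y z.
by have := C_mesh ix iy; have := C_mesh jy jz; have := m_ge0 l; lra.
Qed.

Let par l i : nat := sval (cid (parent_ex l i)).

Let par_sub l i j : meet l i j -> C l j `<=` C (l + 1) (par l i).
Proof. by rewrite /par; case: cid => k [] /= + _; exact. Qed.

Let par_base l i : near_base l i -> par l i = base (l + 1).
Proof. by rewrite /par; case: cid => k []. Qed.

(** The list is finite: the parent of any member meeting [i] contains [i], hence a fixed point of
    it, and that point has bounded multiplicity. *)
Let up_ex l i : exists s : seq nat, forall k,
  (k \in s) <-> exists2 j, meet l i j & par l j = k.
Proof.
have [[x ix]|ni] := pselect (exists x, C l i x); last first.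
  by exists [::] => k; split => // -[j [x ix _]]; case: ni; exists x.
have [s _ sE] := C_multiplicity (l + 1) x.
exists [seq k <- s | `[< exists2 j, meet l i j & par l j = k >]] => k.
rewrite mem_filter; split => [/andP[/asboolP//]|kj].
apply/andP; split; first exact/asboolP.
have [j [y iy jy] <-] := kj; apply/sE; apply: (@par_sub l j i) => //.
by exists y.
Qed.

Let up l i : seq nat := par l i :: sval (cid (up_ex l i)).

Let up_par l i j : meet l i j -> par l j \in up l i.
Proof.
move=> ij; rewrite /up; case: cid => /= s sE; rewrite inE; apply/orP; right.
by apply/sE; exists j.
Qed.

Let upE l i k x : C l i x -> k \in up l i -> exists2 j, meet l i j & par l j = k.
Proof.
move=> ix; rewrite /up inE; case: cid => /= s sE /orP[/eqP->|/sE//].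
by exists i => //; exists x.
Qed.

Let up_sub l i k x : C l i x -> k \in up l i -> C (l + 1) k x.
Proof.
move=> ix /(upE ix)[j [y iy jy] <-]; apply: (@par_sub l j i) => //.
by exists y.
Qed.

Let up_base l i k : meet l i (base l) -> k \in up l i -> k = base (l + 1).
Proof.
move=> ib; have [x ix _] := ib; move=> /(upE ix)[j ij <-]; apply: par_base.
by exists i => //; case: ij => y; exists y.
Qed.

Let base_mono l x : C l (base l) x -> C (l + 1) (base (l + 1)) x.
Proof.
move=> bx; have bb : meet l (base l) (base l) by exists x.
by rewrite -(@up_base l (base l) (par l (base l)))//; [exact: (par_sub bb)|exact: mem_head].
Qed.

Let base_le l k x : C l (base l) x -> C (l + k%:Z) (base (l + k%:Z)) x.
Proof.
move=> bx; elim: k => [|k /base_mono]; first by rewrite addr0.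
by have -> : l + k%:Z + 1 = l + k.+1%:Z by lia.
Qed.

(* Names are read off from the levels above; at depth [f], where everything in
   sight is the base element, the recursion stops. *)
Fixpoint fuel_name f l i : nat :=
  if i == base l then 0%N else
  mkname i (map (if f is f'.+1 then fuel_name f' (l + 1) else fun=> 0%N) (up l i)).

Let fuel_nameS f l i : fuel_name f.+1 l i =
  if i == base l then 0%N else mkname i (map (fuel_name f (l + 1)) (up l i)).
Proof. by []. Qed.

(** The fuel [f] suffices for a member that meets the base member [f] scales up. *)
Let grounded f l i := exists2 x, C l i x & C (l + f%:Z) (base (l + f%:Z)) x.

Let grounded_up f l i k : grounded f.+1 l i -> k \in up l i -> grounded f (l + 1) k.
Proof.
move=> [x ix Bx] ki; exists x; first exact: up_sub ki.
by have <- : l + f.+1%:Z = l + 1 + f%:Z by lia.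
Qed.

Let groundedS f l i : grounded f l i -> grounded f.+1 l i.
Proof.
move=> [x ix /base_mono Bx]; exists x => //.
by have -> : l + f.+1%:Z = l + f%:Z + 1 by lia.
Qed.

Let fuel_name_stable f l i : grounded f l i -> fuel_name f l i = fuel_name f.+1 l i.
Proof.
elim: f l i => [|f IH] l i gi; rewrite fuel_nameS.
  rewrite /fuel_name; case: eqP => // _; congr mkname.
  (* With no fuel left the member meets the base, so its upper indices are all the base, whose name
     0 is the default used. *)
  apply/eq_in_map => k ki; have -> : k = base (l + 1); last by rewrite /= eqxx.
  by apply: (up_base _ ki); case: gi => x; rewrite addr0 => *; exists x.
rewrite fuel_nameS; case: eqP => // _; congr mkname.
apply/eq_in_map => k ki; exact: IH (grounded_up gi ki).
Qed.

Let grounded_ex l i x : C l i x -> exists f, grounded f l i.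
Proof.
move=> ix; have [l' x0x] := m_exhaust x.
have Bx : C (l' + 1) (base (l' + 1)) x.
  by apply: base_sub; apply: le_trans x0x _; have := m_ge0 l'; lra.
have [f [k lf]] : exists f k : nat, l + f%:Z = l' + 1 + k%:Z.
  have [ll|ll] := leP l (l' + 1).
    by exists `|(l' + 1 - l)%R|%N, 0%N; lia.
  by exists 0%N, `|(l - (l' + 1))%R|%N; lia.
by exists f, x => //; rewrite lf; exact: base_le.
Qed.

(** Some sufficient fuel is picked; by [fuel_name_stable] the name does not depend on which. *)
Let name l i : nat := fuel_name (xget 0%N [set f | grounded f l i]) l i.

Let nameE f l i : grounded f l i -> name l i = fuel_name f l i.
Proof.
move=> gf; rewrite /name; have /= := @xgetPex _ 0%N [set f | grounded f l i].
move=> /(_ (ex_intro _ f gf)); move: (xget _ _) => g gg.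
have mono h k : grounded h l i -> fuel_name h l i = fuel_name (h + k) l i /\ grounded (h + k) l i.
  move=> gh; elim: k => [|k [-> gk]]; first by rewrite addn0.
  by rewrite addnS fuel_name_stable//; split => //; exact: groundedS.
by rewrite (mono g f gg).1 (mono f g gf).1 addnC.
Qed.

Let name_rec l i x : C l i x ->
  name l i = if i == base l then 0%N else mkname i (map (name (l + 1)) (up l i)).
Proof.
move=> ix; have [f gf] := grounded_ex ix.
rewrite (nameE (groundedS gf)) fuel_nameS; case: eqP => // _; congr mkname.
by apply/eq_in_map => k ki; rewrite (nameE (grounded_up (groundedS gf) ki)).
Qed.

Let name_base l : name l (base l) = 0%N.
Proof. by rewrite (name_rec (base_x0 l)) eqxx. Qed.

Let name_inj l i j x y : C l i x -> C l j y -> name l i = name l j -> i = j.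
Proof.
move=> /name_rec -> /name_rec ->; case: eqP => [->|_]; case: eqP => [->//|_].
- by move=> /esym /mkname_neq0.
- by move=> /mkname_neq0.
- exact: mkname_inj.
Qed.

Let upper_name l i x : C l i x ->
  upper (name l i) = if i == base l then [:: 0%N] else map (name (l + 1)) (up l i).
Proof. by move=> /name_rec ->; case: eqP => // _; rewrite upper_mkname. Qed.

Let parent_name l i x : C l i x -> parent (name l i) = name (l + 1) (par l i).
Proof.
move=> ix; rewrite /parent (upper_name ix); case: eqP => [ib|//].
rewrite (@up_base l i (par l i)) ?name_base//; last exact: mem_head.
by rewrite -ib; exists x.
Qed.

Let idx l x : seq nat := s2val (cid2 (C_multiplicity l x)).

Let idx_size l x : (size (idx l x) <= n.+1)%N.
Proof. by rewrite /idx; case: cid2. Qed.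

Let idxP l i x : reflect (C l i x) (i \in idx l x).
Proof. by rewrite /idx; case: cid2 => /= s _ sE; apply: (iffP idP) => /sE. Qed.

Let thread_of_subproof x : thread_axiom n (fun l => map (name l) (idx l x)).
Proof.
split=> [l|]; last first.
  have [l x0x] := m_exhaust x; exists (l + 1); rewrite -(name_base (l + 1)).
  apply: map_f; apply/idxP/base_sub; apply: le_trans x0x _.
  by have := m_ge0 l; lra.
split.
- have [i xi] := C_lebesgue (l - 1) x; have /idxP : C l i x.
    by rewrite -[l](subrK 1); apply: xi; rewrite /= deltaxx mulr_ge0.
  by case: (idx l x).
- by rewrite size_map.
- move=> _ _ /mapP[i /idxP ix ->] /mapP[j /idxP jx ->].
  (* If [j] is the base, then [i] meets it at [x], so the parent of [i] is the next base, named 0 as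
     required. *)
  rewrite (parent_name ix) (upper_name jx); case: eqP => [jb|_].
    rewrite (@up_base l i (par l i)) ?mem_head ?name_base ?inE//.
    by exists x; rewrite // -jb.
  by apply: map_f; apply: up_par; exists x.
- move=> _ /mapP[i /idxP ix ->] v; rewrite (upper_name ix); case: eqP => [ib|_].
    rewrite inE => /eqP ->; rewrite -(name_base (l + 1)); apply/map_f/idxP.
    by apply: base_mono; rewrite -ib.
  by move=> /mapP[k ki ->]; apply/map_f/idxP; exact: up_sub ki.
Qed.

Let thread_of x := Thread (thread_of_subproof x).

Let touch_thread_of l x y :
  touch l (thread_of x) (thread_of y) <-> exists2 i, C l i x & C l i y.
Proof.
split=> [/touchP[v]|[i /idxP ix /idxP iy]].
  move=> /mapP[i /idxP ix ->] /mapP[j /idxP jy] /(name_inj ix jy) ij.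
  by exists i => //; rewrite ij.
by apply/touchP; exists (name l i); exact: map_f.
Qed.

(** Touching at scale [l] means lying in a common member at scale [l]. Mesh gives the second
    estimate; the Lebesgue condition gives a common member one scale up, whence the exponent l + 1.
    Since [delta] is a pseudometric and [m] may vanish, a space may be altered at the scales that do
    not matter. *)
Lemma embedding : exists f : X -> universal R n,
  (forall l x y, delta x y <= m l -> mdist (f x) (f y) <= 2 ^ (l + 1)) /\
  (forall l x y, mdist (f x) (f y) < 2 ^ l -> delta x y <= m l).
Proof.
exists (fun x => of_thread R (thread_of x)); split=> l x y; rewrite mdist_of_thread.
  move=> xy; apply/tdist_touch/touch_thread_of; have [i xi] := C_lebesgue l x.
  exists i; apply: xi => /=; first by rewrite deltaxx mulr_ge0.
  by apply: le_trans xy _; have := m_ge0 l; lra.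
by move=> /touch_tdist /touch_thread_of [i]; exact: C_mesh.
Qed.

End embedding.

(** * The lower bound *)

Lemma finite_enum (P : nat -> Prop) (N : nat) :
  (forall s : seq nat, uniq s -> (forall i, i \in s -> P i) -> (size s <= N)%N) ->
  exists2 s : seq nat, (size s <= N)%N & forall i, (i \in s) <-> P i.
Proof.
move=> bd; have [fP|/(infinite_set_fset N.+1) [B BP NB]] := pselect (finite_set [set i | P i]).
  have [B BE] := finite_fsetP.1 fP; exists (finmap.enum_fset B).
    apply: bd => [|i iB]; first exact: finmap.fset_uniq.
    by have : [set i | P i] i by rewrite BE.
  by move=> i; rewrite -[P i]/([set i | P i] i) BE.
suff : (size (finmap.enum_fset B) <= N)%N by rewrite leqNgt NB.
by apply: bd => [|i iB]; [exact: finmap.fset_uniq | exact: BP].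
Qed.

(** * Stars of the Freudenthal triangulation *)

Section euclidean.
Variables (R : realType) (n : nat).
Implicit Types (x y z : 'I_n -> R) (v w : {ffun 'I_n -> int}).

Definition supdist x y : R := \big[Num.max/0]_(i < n) `|x i - y i|.

Lemma supdist_leP (r : R) x y : 0 <= r ->
  reflect (forall i, `|x i - y i| <= r) (supdist x y <= r).
Proof.
move=> r0; apply: (iffP idP) => [le_r i|le_r]; last exact: bigmax_le.
exact: le_trans (le_bigmax _ (fun i => `|x i - y i|) i) le_r.
Qed.

Lemma supdist_ge0 x y : 0 <= supdist x y.
Proof. exact: bigmax_ge_id. Qed.

Lemma supdist_ge i x y : `|x i - y i| <= supdist x y.
Proof. exact: le_bigmax. Qed.

Lemma supdistxx x : supdist x x = 0.
Proof.
apply/eqP; rewrite eq_le supdist_ge0 andbT; apply/supdist_leP => // i.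
by rewrite subrr normr0.
Qed.

Lemma supdist_triangle x y z : supdist x z <= supdist x y + supdist y z.
Proof.
apply/supdist_leP => [|i]; first by rewrite addr_ge0 ?supdist_ge0.
apply: le_trans (ler_distD (y i) _ _) _.
by apply: lerD; exact: supdist_ge.
Qed.

(* The open star of the vertex 0 in the Freudenthal triangulation. *)
Definition star z := (forall i, `|z i| < 1) /\ (forall i j, `|z i - z j| < 1).

Definition offset x v : 'I_n -> R := fun i => x i - (v i)%:~R.

Lemma star_floor x v i : star (offset x v) ->
  x i - 1 < (v i)%:~R < x i + 1.
Proof. by case=> + _ => /(_ i); rewrite ltr_norml /offset; lra. Qed.

(** The vertices whose stars contain [x] are linearly ordered, so the number of coordinates where a
    vertex exceeds [x] determines it. This number is at most n, whence multiplicity n+1. *)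
Lemma star_vertex_inj x v w : star (offset x v) -> star (offset x w) ->
  #|[pred i | x i < (v i)%:~R]| = #|[pred i | x i < (w i)%:~R]| -> v = w.
Proof.
wlog vw : v w / [pred i | x i < (v i)%:~R] \subset [pred i | x i < (w i)%:~R].
  move=> wl sv sw.
  have [vw|/fintype.subsetPn[i iv iw]] := boolP
    ([pred i | x i < (v i)%:~R] \subset [pred i | x i < (w i)%:~R]).
    exact: wl.
  move=> vw; apply/esym; apply: (wl w v) => //.
  apply/fintype.subsetP => j; rewrite !inE => jw.
  rewrite ltNge; apply/negP => jv; move: iv iw; rewrite !inE -leNgt => iv iw.
  (* Incomparable vertices are impossible: the differences of the coordinates [i] and [j] of the two
     offsets would be 2 or more apart, yet both lie in (-1, 1). *)
  have hi : ((w i)%:~R + 1 <= (v i)%:~R :> R).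
    by rewrite -[1]/(1%:~R) -intrD ler_int lezD1 -(ltr_int R) (le_lt_trans iw).
  have hj : ((v j)%:~R + 1 <= (w j)%:~R :> R).
    by rewrite -[1]/(1%:~R) -intrD ler_int lezD1 -(ltr_int R) (le_lt_trans jv).
  have := sv.2 i j; have := sw.2 i j; rewrite !ltr_norml /offset.
  by move=> /andP[? ?] /andP[? ?]; clear vw wl; lra.
move=> sv sw cvw.
have /fintype.subsetP wv : [pred i | x i < (w i)%:~R] \subset [pred i | x i < (v i)%:~R].
  by rewrite -(subset_leqif_card vw).2 cvw eqxx.
move/fintype.subsetP: vw => vw.
apply/ffunP => i; apply/eqP; rewrite eq_le.
have /andP[v1 v2] := star_floor i sv; have /andP[w1 w2] := star_floor i sw.
have := vw i; have := wv i; rewrite !inE => wvi vwi.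
clear cvw vw wv.
rewrite -![(_ <= _ :> int)]ltzD1 -!(ltr_int R) !intrD -![1%:~R]/1.
have [xv|xv] := ltP (x i) (v i)%:~R.
  by have := vwi xv => xw; apply/andP; split; lra.
have xw : (w i)%:~R <= x i by rewrite leNgt; apply/negP => /wvi; rewrite ltNge xv.
by apply/andP; split; lra.
Qed.

Lemma star_cover x : exists v, forall y,
  (forall i, `|y i - x i| < (2 * n.+1%:R)^-1) -> star (offset y v).
Proof.
have N0 : 0 < n.+1%:R :> R by rewrite ltr0n.
pose fl i : int := Num.floor (x i); pose fr i := x i - (fl i)%:~R.
have fr0 i : 0 <= fr i by rewrite subr_ge0 ge_floor.
have fr1 i : fr i < 1.
  by have := floorD1_gt (x i); rewrite /fr /fl intrD; move: (Num.floor _) => k; lra.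
(* Pigeonhole: n fractional parts cannot occupy all n+1 intervals of length 1/(n+1). *)
have [a gap] : exists a : 'I_n.+1, forall i,
    n.+1%:R * fr i < a%:R \/ a%:R + 1 <= n.+1%:R * fr i.
  apply/not_existsP => nogap.
  have {nogap} /choice[g gP] : forall a : 'I_n.+1, exists i : 'I_n,
      a%:R <= n.+1%:R * fr i < a%:R + 1.
    move=> a; have /existsNP[i /not_orP[/negP + /negP]] := nogap a.
    by rewrite -leNgt -ltNge => h1 h2; exists i; rewrite h1 h2.
  have : injective g.
    have lt_a (a b : 'I_n.+1) : g a = g b -> (a < b)%N -> False.
      move=> gab; rewrite -(ler_nat R) -natr1 => ab.
      by have := gP a; have := gP b; rewrite gab => /andP[? ?] /andP[? ?]; lra.
    move=> a b gab; apply/val_inj => /=.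
    by case: (ltngtP a b) => // [/(lt_a _ _ gab)|/(lt_a _ _ (esym gab))].
  by move=> /leq_card; rewrite !card_ord ltnn.
(* Rounding up above the gap and down below it puts the coordinates of n+1 times x - v in an
   interval of length n inside [-n, n], with room for perturbations below 1/2. *)
pose up i : bool := a%:R + 1 <= n.+1%:R * fr i.
pose v : {ffun 'I_n -> int} := [ffun i => fl i + (up i : nat)%:Z].
exists v => y yx.
have an : (a%:R <= n%:R :> R) by rewrite ler_nat -ltnS.
have N1 : n.+1%:R = n%:R + 1 :> R by rewrite natr1.
have a0 : 0 <= a%:R :> R by rewrite ler0n.
have bound i : a%:R + 1 - n.+1%:R <= n.+1%:R * (x i - (v i)%:~R) < a%:R.
  rewrite /v ffunE intrD.
  have -> : x i - ((fl i)%:~R + (Posz (up i))%:~R) = fr i - (up i)%:R.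
    by rewrite /fr opprD addrA.
  rewrite /up; move: (gap i) (fr0 i) (fr1 i); move: (fr i) => F gF.
  rewrite mulrBr -(ltr_pM2l N0) -(ler_pM2l N0) mulr1 mulr0 => h0 h1.
  have [h|h] := leP (a%:R + 1) (n.+1%:R * F); rewrite /= ?mulr1 ?mulr0.
    by apply/andP; split; lra.
  case: gF => [h2|]; last by lra.
  by apply/andP; split; lra.
have yb i : - (2^-1) < n.+1%:R * (y i - x i) < 2^-1.
  rewrite -ltr_norml normrM gtr0_norm// mulrC -ltr_pdivlMr// -invfM.
  exact: yx.
have sh i : n.+1%:R * offset y v i = n.+1%:R * (y i - x i) + n.+1%:R * (x i - (v i)%:~R).
  by rewrite /offset -mulrDr; congr (_ * _); lra.
split=> [i|i j]; rewrite -(ltr_pM2l N0) mulr1 -[X in X * `|_|]gtr0_norm// -normrM.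
  rewrite sh ltr_norml; have := yb i; have := bound i.
  by move=> /andP[? ?] /andP[? ?]; apply/andP; split; lra.
rewrite mulrBr !sh ltr_norml; have := yb i; have := bound i; have := yb j; have := bound j.
by move=> /andP[? ?] /andP[? ?] /andP[? ?] /andP[? ?]; apply/andP; split; lra.
Qed.

End euclidean.

(** * Euclidean space inside the universal space *)

Section euclidean_embedding.
Variables (R : realType) (n : nat).
Implicit Types (x y z : 'I_n -> R) (v w : {ffun 'I_n -> int}) (l : int).

(** At scale [l] the stars have mesh at most 2 * h l. The next scale admits balls of radius below h
    (l + 1) / (2 (n+1)) = 25 * h l, which exceeds the required 20 * h l. *)
Let c : R := 50 * n.+1%:R.

Let c_ge50 : 50 <= c.
Proof. by rewrite /c ler_peMr// ler1n. Qed.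

Let c_gt0 : 0 < c.
Proof. by have := c_ge50; lra. Qed.

Let h l : R := c ^ l.

Let h_gt0 l : 0 < h l. Proof. exact: exprz_gt0. Qed.

Let hS l : h (l + 1) = c * h l.
Proof. by rewrite /h expfzDr ?gt_eqF// expr1z mulrC. Qed.

Let scale l x : 'I_n -> R := fun i => x i / h l.

Let stars l (k : nat) : set ('I_n -> R) :=
  [set x | exists2 v : {ffun 'I_n -> int}, pickle v = k & star (offset (scale l x) v)].

Let stars_mesh l k x y : stars l k x -> stars l k y -> supdist x y <= 2 * h l.
Proof.
move=> [v <- [xv _]] [w /(pcan_inj pickleK) -> [yv _]].
have h0 := h_gt0 l; apply/supdist_leP => [|i]; first by rewrite mulr_ge0// ltW.
have -> : x i - y i = h l * (offset (scale l x) v i - offset (scale l y) v i).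
  by rewrite /offset /scale; field; rewrite gt_eqF.
rewrite normrM gtr0_norm// mulrC ler_pM2r//.
apply: le_trans (ler_normB _ _) _.
by have := xv i; have := yv i; lra.
Qed.

Let stars_lebesgue l x : exists k,
  [set y | supdist x y <= 10 * (2 * h l)] `<=` stars (l + 1) k.
Proof.
have [v vP] := star_cover (scale (l + 1) x); exists (pickle v) => y /= xy.
exists v => //; apply: vP => i; have h0 := h_gt0 l.
have -> : scale (l + 1) y i - scale (l + 1) x i = (y i - x i) / (c * h l).
  by rewrite /scale hS mulrBl.
rewrite normrM distrC normfV [`|c * _|]gtr0_norm ?mulr_gt0//.
rewrite ltr_pdivrMr ?mulr_gt0//; apply: le_lt_trans (supdist_ge i x y) _.
apply: le_lt_trans xy _; rewrite !mulrA ltr_pM2r// ?/c.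
suff -> : (2 * n.+1%:R)^-1 * 50 * n.+1%:R = 25 :> R by lra.
by field.
Qed.

Let stars_multiplicity l x : exists2 s : seq nat,
  (size s <= n.+1)%N & forall k, (k \in s) <-> stars l k x.
Proof.
apply: finite_enum => s us sP.
pose dec k : {ffun 'I_n -> int} := odflt [ffun=> 0] (unpickle k).
have sdec k : k \in s -> pickle (dec k) = k /\ star (offset (scale l x) (dec k)).
  by move=> /sP[v <- sv]; rewrite /dec pickleK.
pose above k := #|[pred i | scale l x i < (dec k i)%:~R]|.
rewrite -(size_map above) -(size_iota 0 n.+1); apply: uniq_leq_size.
  rewrite map_inj_in_uniq// => j k /sdec[jE sj] /sdec[kE sk] jk.
  by rewrite -[LHS]jE -[RHS]kE (star_vertex_inj sj sk jk).
move=> _ /mapP[k _ ->]; rewrite mem_iota /= add0n ltnS.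
by rewrite -[leqRHS]card_ord max_card.
Qed.

Lemma euclidean_embedding : exists (f : ('I_n -> R) -> universal R n) (m : int -> R),
  [/\ forall l, 0 < m l,
   forall l x y, supdist x y <= m l -> mdist (f x) (f y) <= 2 ^ (l + 1) &
   forall l x y, mdist (f x) (f y) < 2 ^ l -> supdist x y <= m l].
Proof.
have [||l||||x|f [f1 f2]] := @embedding R _ n (@supdist R n) (fun=> 0) stars (fun l => 2 * h l).
- exact: supdistxx.
- exact: supdist_triangle.
- by rewrite mulr_ge0// ltW// h_gt0.
- exact: stars_mesh.
- exact: stars_lebesgue.
- exact: stars_multiplicity.
- exists (Num.bound (supdist (fun=> 0) x))%:Z.
  apply: ltW; apply: lt_le_trans (upper_nthrootP (leqnn _)) _.
  rewrite -[h _]/(c ^+ _); apply: (@le_trans _ _ (c ^+ Num.bound (supdist (fun=> 0) x))).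
    by apply: lerXn2r; rewrite ?nnegrE; have := c_ge50; lra.
  by rewrite ler_peMl ?exprn_ge0 ?ler1n// ltW.
- by exists f, (fun l => 2 * h l); split => // l; rewrite mulr_gt0.
Qed.

End euclidean_embedding.

(** * Excluding covers of multiplicity n *)

Section lower_bound.
Variables (R : realType) (n : nat).
Local Notation U := (universal R n).

Lemma no_small_cover (W : set (set U)) (e : R) :
  lebesgue_number W e -> (mesh W < +oo)%E -> ~ multiplicity_le W (n%:Z - 1 + 1).
Proof.
move=> [e0 We] Wfin Wn; have [f [m [m0 f1 f2]]] := euclidean_embedding R n.
have [b Wb] : exists b, (mesh W < (2 ^ b : R)%:E)%E.
  have W0 : (0 <= mesh W)%E by apply: ereal_sup_ubound; left.
  have /fineK <- : mesh W \is a fin_num by rewrite ge0_fin_numE.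
  by have [b fb] := pow2_large (fine (mesh W)); exists b; rewrite lte_fin.
have [a ae] := pow2_small e0.
(* Balls of radius [h] have diameter at most m (a - 1), so their images have diameter at most 2 ^ a
   < e and fit in members of [W]. *)
pose h := m (a - 1) / 2; have h0 : 0 < h by rewrite divr_gt0.
pose pt (u : nat -> nat) : 'I_n -> R := fun i => h * (u i)%:R.
have /choice[V VP] : forall u, exists V : set U,
    W V /\ [set f x | x in [set x | supdist x (pt u) <= h]] `<=` V.
  move=> u; suff : (diam [set f x | x in [set x | (supdist x (pt u) <= h)%R]] < e%:E)%E.
    by move=> /We[V WV uV]; exists V.
  apply: (@le_lt_trans _ _ (2 ^ a : R)%:E); last by rewrite lte_fin.
  apply: diam_le => [|_ _ [x /= xu <-] [y /= yu <-]]; first exact/ltW/pow2_gt0.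
  rewrite -[a](subrK 1); apply: f1; apply/supdist_leP => [|i]; first exact: ltW.
  have dx := le_trans (supdist_ge i x (pt u)) xu.
  have dy := le_trans (supdist_ge i y (pt u)) yu.
  apply: le_trans (ler_distD (pt u i) _ _) _; rewrite [`|pt u i - _|]distrC.
  by apply: le_trans (lerD dx dy) _; rewrite /h -splitr.
have Vsep u u' (i : 'I_n) : V u = V u' -> h * `|(u i)%:R - (u' i)%:R| <= m b.
  move=> uu'; have inV u1 : V u1 (f (pt u1)).
    by apply: (VP u1).2; exists (pt u1) => //=; rewrite supdistxx ltW.
  have /(mdist_le_mesh (VP u).1 (inV u)) : V u (f (pt u')) by rewrite uu'.
  move=> /le_lt_trans/(_ Wb); rewrite lte_fin => /f2 /(le_trans _); apply.
  apply: le_trans (supdist_ge i _ _).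
  by rewrite /pt -mulrBr normrM (gtr0_norm h0).
(* The grid is so wide that points on opposite sides never choose the same member. *)
have [N NP] : exists N : nat, m b < h * N%:R.
  exists (Num.bound (m b / h)); rewrite mulrC -ltr_pdivrMr//.
  by apply: archi_boundP; rewrite divr_ge0// ltW.
pose side (A : set U) (i : nat) := `[< exists2 u, V u = A & u i = 0%N >].
(* The label depends only on the chosen member: the first [i] for which that member is also chosen
   at a point with i-th coordinate 0, and n if there is none. *)
pose lam u := find (side (V u)) (iota 0 n).
have lam0 u i : (i < n)%N -> u i = 0%N -> (lam u <= i)%N.
  move=> i_n ui; rewrite leqNgt; apply/negP => /(before_find 0%N).
  by rewrite nth_iota// add0n => /asboolP; apply; exists u.
have lamN u i : (i < n)%N -> u i = N -> lam u != i.
  move=> i_n uN; apply/eqP => lami.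
  have : has (side (V u)) (iota 0 n) by rewrite has_find -/(lam u) lami size_iota.
  move=> /(nth_find 0%N); rewrite -/(lam u) lami nth_iota// add0n.
  move=> /asboolP[u' u'u u'0]; have := Vsep u' u (Ordinal i_n) u'u.
  by rewrite /= u'0 uN sub0r normrN normr_nat leNgt NP.
have lamn u : (lam u <= n)%N by rewrite -[leqRHS](size_iota 0) find_size.
have [u0 u0P] := sperner lamn lam0 lamN.
have /choice[g gP] : forall j, exists u, (j <= n)%N -> near_pt n u0 u /\ lam u = j.
  move=> j; have [/u0P[u u0u uj]|nj] := boolP (j <= n)%N; first by exists u.
  by exists u0 => jn; case/negP: nj.
have inj : {in `I_n.+1 &, injective (V \o g)}.
  move=> j k; rewrite !inE /= !ltnS => /gP[_ jE] /gP[_ kE] Vjk.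
  by rewrite -jE -kE /lam Vjk.
suff : n.+1%:Z <= n%:Z - 1 + 1 by lia.
(* Different labels mean different members, and all n+1 contain the image of the grid point [u0],
   which is within one grid step [h] of every chosen vertex. *)
apply: (Wn n.+1 ((V \o g) @` `I_n.+1)); last exists (f (pt u0)).
- by move=> _ [j _ <-]; exact: (VP _).1.
- exact: inj_card_eq.
- move=> _ [j /= jn <-]; have [near_j _] := gP j jn.
  apply: (VP (g j)).2; exists (pt u0) => //=; apply/supdist_leP => [|i].
    exact: ltW.
  rewrite /pt -mulrBr normrM (gtr0_norm h0) ler_piMr ?(ltW h0)//.
  have /allP/(_ (val i)) := near_j; rewrite mem_iota /= add0n ltn_ord => /(_ isT).
  rewrite -!(ler_nat R) -!natr1 => /andP[h1 h2].
  by rewrite ler_norml; apply/andP; split; lra.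
Qed.

End lower_bound.

(** * Universality *)

Section moduli.
Context {R : realType} {X Y : metricType R}.
Variable f : X -> Y.

(** This and [upper_modulus] are the best possible gauges for [f]; the infimum is +oo when no two
    points are [r] apart. *)
Definition lower_modulus (r : R) : \bar R :=
  ereal_inf [set (mdist (f z.1) (f z.2))%:E | z in [set z | r <= mdist z.1 z.2]].

Definition upper_modulus (r : R) : \bar R :=
  ereal_sup (0%E |` [set (mdist (f z.1) (f z.2))%:E | z in [set z | mdist z.1 z.2 <= r]]).

Lemma upper_modulus_ge0 r : (0 <= upper_modulus r)%E.
Proof. by apply: ereal_sup_ubound; left. Qed.

Lemma upper_modulus_le r e : 0 <= e ->
  (forall x y, mdist x y <= r -> mdist (f x) (f y) <= e) -> (upper_modulus r <= e%:E)%E.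
Proof.
move=> e0 fe; apply: ge_ereal_sup => _ [->|[[x y] /= xy <-]].
  by rewrite lee_fin.
by rewrite lee_fin fe.
Qed.

Lemma lower_modulus_ge r e :
  (forall x y, r <= mdist x y -> e <= mdist (f x) (f y)) -> (e%:E <= lower_modulus r)%E.
Proof.
by move=> fe; apply: le_ereal_inf_tmp => _ [[x y] /= xy <-]; rewrite lee_fin fe.
Qed.

Lemma controlled_moduli : controlled f lower_modulus upper_modulus.
Proof.
split.
- split=> [r _|r s _ rs].
    by apply: le_ereal_inf_tmp => _ [[x y] _ <-]; rewrite lee_fin mdist_ge0.
  apply: ereal_inf_le_tmp => _ [[x y] /= xy <-]; exists (x, y) => //=.
  exact: le_trans xy.
- split=> [r _|r s _ rs]; first exact: upper_modulus_ge0.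
  apply: ereal_sup_le => _ [->|[[x y] /= xy <-]]; first by left.
  by right; exists (x, y) => //=; exact: le_trans rs.
- move=> x y _; split.
    by apply: ereal_inf_lbound; exists (x, y) => /=.
  by apply: ereal_sup_ubound; right; exists (x, y) => /=.
Qed.

Lemma coarse_embeddingI :
  (forall r, exists M, forall x y, mdist x y <= r -> mdist (f x) (f y) <= M) ->
  (forall M, exists r, forall x y, mdist (f x) (f y) < M -> mdist x y <= r) ->
  coarse_embedding f.
Proof.
move=> fM fr; exists lower_modulus, upper_modulus; split.
- exact: controlled_moduli.
- move=> r _; have [M rM] := fM r; apply: (@le_lt_trans _ _ (Num.max 0 M)%:E).
    apply: upper_modulus_le => [|x y /rM xy]; first by rewrite le_max lexx.
    by rewrite le_max xy orbT.
  exact: ltry.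
- apply/cvgeyPge => M; have [r rM] := fr M.
  near=> s; apply: lower_modulus_ge => x y sxy; rewrite leNgt; apply/negP => /rM.
  rewrite leNgt => /negP; apply; apply: lt_le_trans sxy.
  by near: s; apply: nbhs_pinfty_gt; exact: num_real.
Unshelve. all: end_near. Qed.

Lemma uniform_embeddingI :
  (forall e, 0 < e -> exists2 d, 0 < d &
    forall x y, mdist x y <= d -> mdist (f x) (f y) <= e) ->
  (forall d, 0 < d -> exists2 e, 0 < e &
    forall x y, mdist (f x) (f y) < e -> mdist x y < d) ->
  uniform_embedding f.
Proof.
move=> fd fe; exists lower_modulus, upper_modulus; split.
- exact: controlled_moduli.
- have small e : 0 < e -> \forall r \near 0^'+, (upper_modulus r <= e%:E)%E.
    move=> e0; have [d d0 de] := fd e e0; near=> r.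
    apply: upper_modulus_le => [|x y xy]; first exact: ltW.
    apply: de; apply: le_trans xy _; apply: ltW.
    by near: r; exact: nbhs_right_lt.
  apply/fine_cvgP; split.
    near=> r; rewrite ge0_fin_numE ?upper_modulus_ge0//.
    apply: (@le_lt_trans _ _ 1%:E); last exact: ltry.
    by near: r; exact: small.
  apply/cvgr0Pnorm_le => e e0; near=> r.
  have re : (upper_modulus r <= e%:E)%E by near: r; exact: small.
  rewrite /= ger0_norm ?fine_ge0 ?upper_modulus_ge0// -lee_fin fineK//.
  by rewrite ge0_fin_numE ?upper_modulus_ge0// (le_lt_trans re)// ltry.
- move=> d d0; have [e e0 ed] := fe d d0.
  apply: (@lt_le_trans _ _ e%:E); first by rewrite lte_fin.
  apply: lower_modulus_ge => x y dxy; rewrite leNgt; apply/negP => /ed.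
  by rewrite ltNge dxy.
Unshelve. all: end_near. Qed.

End moduli.

Section onto_range.
Context {R : realType} {X Y : metricType R}.
Variable f : X -> Y.

Definition to_range (x : X) : set_type (range f) := SigSub (mem_set (imageT f x)).

Lemma to_range_surj y : exists x, to_range x = y.
Proof.
by case: y => y yP; have [x _ xy] := set_mem yP; exists x; exact: val_inj.
Qed.

Lemma coarsely_equivalent_range : coarse_embedding f ->
  coarsely_equivalent_to_subset X Y.
Proof.
move=> fc; exists (range f), to_range; split; first exact: fc.
exists 0 => y; have [x <-] := to_range_surj y.
by exists (to_range x); [exists x|rewrite mdistxx].
Qed.

Lemma uniformly_homeomorphic_range : uniform_embedding f ->
  uniformly_homeomorphic_to_subset X Y.
Proof.
move=> fc; exists (range f), to_range; split; first exact: fc.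
by apply/seteqP; split => // y _; have [x <-] := to_range_surj y; exists x.
Qed.

End onto_range.

(** * Indexing covers by natural numbers *)

Section indexed_covers.
Context {R : realType} {X : metricType R} {n : nat}.
Implicit Types W : set (set X).

Lemma finite_multiplicity W (m : int) x : multiplicity_le W m ->
  finite_set [set V | W V /\ V x].
Proof.
move=> Wm; apply: contrapT => infW.
have /card_subP[F Fk FW] : (`I_(`|m|.+1) #<= [set V | W V /\ V x])%card.
  by have /infiniteP := infW; apply: card_le_trans; exact: subset_card_le.
have := Wm _ F _ Fk; apply/not_implyP; split; first by move=> V /FW[].
apply/not_implyP; split; first by exists x => V /FW[].
by lia.
Qed.

(** Each non-empty open member contains a point of the countable dense set, and each point lies in
    finitely many members. *)
Lemma countable_members W (m : int) : separable X -> open_cover W ->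
  multiplicity_le W m -> countable [set V | W V /\ V !=set0].
Proof.
move=> [S Sc Sd] [Wo _] Wm.
apply: (@sub_countable _ _ _ (\bigcup_(x in S) [set V | W V /\ V x])).
  apply: subset_card_le => V [WV V0]; have [x [Vx Sx]] := Sd V V0 (Wo V WV).
  by exists x.
apply: bigcup_countable => // x _; apply: finite_set_countable.
exact: finite_multiplicity Wm.
Qed.

(* An index may carry the empty set. *)
Lemma indexed_cover W : separable X -> open_cover W ->
    multiplicity_le W (n%:Z + 1) ->
  exists C : nat -> set X,
    [/\ forall i x, C i x -> W (C i),
        forall V x, W V -> V x -> exists i, C i = V &
        forall x, exists2 s : seq nat,
          (size s <= n.+1)%N & forall i, (i \in s) <-> C i x].
Proof.
move=> Xs Wo Wm; have /countable_injP[g ginj] := countable_members Xs Wo Wm.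
pose W' := [set V | W V /\ V !=set0].
pose C i : set X := \bigcup_(V in [set V | W' V /\ g V = i]) V.
have CE V : W' V -> C (g V) = V.
  move=> VW; apply/seteqP; split => x; last by move=> Vx; exists V.
  by move=> [V' [VW' gV] V'x]; rewrite -(ginj V' V)// inE.
have CW i x : C i x -> W' (C i) /\ g (C i) = i.
  by move=> [V [VW <-] _]; rewrite CE.
exists C; split.
- by move=> i x /CW[[]].
- by move=> V x WV Vx; exists (g V); apply: CE; split => //; exists x.
- move=> x; apply: finite_enum => s us sC.
  have inj : {in `I_(size s) &, injective (C \o nth 0%N s)}.
    move=> i j; rewrite !inE /= => si sj Cij; apply/eqP.
    rewrite -(nth_uniq 0%N _ _ us)//; apply/eqP.
    have [_ <-] := CW _ x (sC _ (mem_nth 0%N si)).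
    by have [_ <-] := CW _ x (sC _ (mem_nth 0%N sj)); rewrite Cij.
  have := Wm (size s) ((C \o nth 0%N s) @` `I_(size s)).
  suff h : (size s)%:Z <= n%:Z + 1 -> (size s <= n.+1)%N.
    move=> H; apply/h/H; last exists x.
    + by move=> _ [i /= si <-]; have [[]] := CW _ x (sC _ (mem_nth 0%N si)).
    + exact: inj_card_eq.
    + by move=> _ [i /= si <-]; exact/sC/mem_nth.
  by clear; lia.
Qed.

End indexed_covers.

(** * Graded covers from dimension bounds *)

Section universality.
Context {R : realType} {X : metricType R} {n : nat}.
Hypothesis X_sep : separable X.
Implicit Types (x y z : X).

Definition indexed_family (C : nat -> set X) (leb M : R) : Prop :=
  [/\ forall x, exists i, [set y | mdist x y <= leb] `<=` C i,
      forall i x y, C i x -> C i y -> mdist x y <= M &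
      forall x, exists2 s : seq nat,
        (size s <= n.+1)%N & forall i, (i \in s) <-> C i x].

Lemma diam_ball x (r : R) : 0 <= r ->
  (diam [set y | (mdist x y <= r)%R] <= (2 * r)%:E)%E.
Proof.
move=> r0; apply: diam_le => [|y z /= xy xz]; first by rewrite mulr_ge0.
apply: le_trans (metric_triangle y x z) _; rewrite (metric_sym y x).
by lra.
Qed.

Lemma asdim_family (r : R) : asdim_le X n%:Z -> 0 <= r ->
  exists C M, indexed_family C r M.
Proof.
move=> Xn r0; have [W [Wo [e re [_ We]] Wfin Wm]] := Xn (2 * r).
have [C [CW WC Cm]] := indexed_cover X_sep Wo Wm.
exists C, (fine (mesh W)); split => // [x|i x y Cx Cy].
  have [|V WV xV] := We [set y | mdist x y <= r].
    by apply: le_lt_trans (diam_ball x r0) _; rewrite lte_fin.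
  have Vx : V x by apply: xV; rewrite /= mdistxx.
  by have [i iV] := WC V x WV Vx; exists i; rewrite iV.
rewrite -lee_fin fineK; first exact: mdist_le_mesh (CW i x Cx) Cx Cy.
by rewrite ge0_fin_numE//; apply: ereal_sup_ubound; left.
Qed.

Lemma udim_family (r : R) : udim_le X n%:Z -> 0 < r ->
  exists C e, 0 < e /\ indexed_family C e r.
Proof.
move=> Xn r0; have [W [Wo Wr [e [e0 We]] Wm]] := Xn r r0.
have [C [CW WC Cm]] := indexed_cover X_sep Wo Wm.
exists C, (e / 3); split; first by rewrite divr_gt0.
split => // [x|i x y Cx Cy].
  have [|V WV xV] := We [set y | mdist x y <= e / 3].
    apply: le_lt_trans (diam_ball x _) _; first by lra.
    by rewrite lte_fin; lra.
  have Vx : V x by apply: xV; rewrite /= mdistxx; lra.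
  by have [i iV] := WC V x WV Vx; exists i; rewrite iV.
rewrite -lee_fin; apply: le_trans (ltW Wr); exact: mdist_le_mesh (CW i x Cx) Cx Cy.
Qed.

(** Only large scales matter, so [X] is collapsed by [r] onto a countable net, whose points are
    separated by singletons at all negative scales. *)
Lemma large_scale_universality : X -> asdim_le X n%:Z ->
  exists f : X -> universal R n, coarse_embedding f.
Proof.
move=> x0 Xn; have [S /countable_injP[g ginj] Sd] := X_sep.
have /choice[r rP] : forall x, exists y, S y /\ mdist x y < 1.
  move=> x; have [|y [xy Sy]] := Sd [set y | mdist x y < 1] _ (open_mball x 1).
    by exists x; rewrite /= mdistxx.
  by exists y.
have g_inj x y : g (r x) = g (r y) -> r x = r y.
  by apply: ginj; rewrite inE; exact: (rP _).1.
(* Adding 1 keeps distinct net points at least 1 apart and preserves the triangle inequality. *)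
pose delta x y : R := if r x == r y then 0 else mdist (r x) (r y) + 1.
have delta_ge x y : mdist x y <= delta x y + 2.
  have := metric_triangle x (r x) y; have := metric_triangle (r x) (r y) y.
  have := (rP x).2; have := (rP y).2; rewrite (metric_sym y (r y)) /delta.
  by case: eqP => [->|_]; rewrite ?mdistxx; lra.
have delta_le x y : delta x y <= mdist x y + 3.
  have := metric_triangle (r x) x (r y); have := metric_triangle x y (r y).
  have := (rP x).2; have := (rP y).2; rewrite (metric_sym (r x) x) /delta.
  have := mdist_ge0 x y.
  by case: eqP => [->|_]; lra.
have deltaE x y (M : R) : 0 <= M -> mdist (r x) (r y) <= M -> delta x y <= M + 1.
  by move=> ? ?; rewrite /delta; case: ifP => _; lra.
have /choice[F FP] : forall s : R, exists p : (nat -> set X) * R,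
    0 <= s -> indexed_family p.1 s p.2.
  move=> s; have [s0|s0] := leP 0 s.
    by have [C [M CM]] := asdim_family Xn s0; exists (C, M).
  by exists (fun=> set0, 0).
(* The 1 pays for the shift in [delta]; the [k] makes the bounds unbounded, as exhaustion
   requires. *)
pose bnd (s : R) (k : nat) := Num.max 0 (F s).2 + 1 + k%:R.
pose fix rad (k : nat) : R := if k is k'.+1 then 10 * bnd (rad k') k' else 0.
have bnd_ge s k : k%:R + 1 <= bnd s k.
  by rewrite /bnd; have : 0 <= Num.max 0 (F s).2; [rewrite le_max lexx | lra].
have bnd_ge0 s k : 0 <= bnd s k.
  by apply: le_trans (bnd_ge s k); rewrite addr_ge0.
have rad_ge0 k : 0 <= rad k.
  by case: k => //= k; rewrite mulr_ge0.
pose C (l : int) i : set X := match l with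
  | Posz k => [set x | (F (rad k)).1 i (r x)] | Negz _ => [set x | g (r x) = i] end.
pose m (l : int) : R := if l is Posz k then bnd (rad k) k else 0.
have m_ge (s : R) : exists l, s <= m l.
  exists (Num.bound `|s|)%:Z; apply: le_trans (bnd_ge _ _).
  by have := archi_boundP (normr_ge0 s); have := ler_norm s; lra.
have famP k : indexed_family (F (rad k)).1 (rad k) (F (rad k)).2 by exact: FP.
have [||l|[k|k] i x y|[k|k] x|[k|k] x|x|f [f1 f2]] :=
  @embedding R X n delta x0 C m.
- by move=> x; rewrite /delta eqxx.
- move=> x y z; rewrite /delta.
  have := metric_triangle (r x) (r y) (r z).
  have := mdist_ge0 (r x) (r y); have := mdist_ge0 (r y) (r z).
  case: (eqVneq (r x) (r y)) => [->|_].
    by rewrite mdistxx; case: eqP => _; lra.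
  case: (eqVneq (r y) (r z)) => [->|_]; first by rewrite mdistxx; case: eqP => _; lra.
  by case: eqP => _; lra.
- by case: l => [k|k] //=; exact: bnd_ge0.
- move=> xi yi; have [_ /(_ i _ _ xi yi) xy _] := famP k.
  apply: (@le_trans _ _ (Num.max 0 (F (rad k)).2 + 1)).
    by apply: deltaE; rewrite le_max ?lexx ?xy ?orbT.
  by rewrite /m /bnd lerDl.
- by move=> /= <- /g_inj xy; rewrite /delta xy eqxx.
- have -> : k%:Z + 1 = k.+1%:Z by lia.
  have [/(_ (r x)) [i xi] _ _] := famP k.+1; exists i => y /= xy; apply: xi => /=.
  apply: le_trans xy; rewrite /delta; case: eqP => [->|_]; first by rewrite mdistxx.
  by lra.
- case: k => [|k].
    have -> : Negz 0 + 1 = 0 by [].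
    have [/(_ (r x)) [i xi] _ _] := famP 0%N; exists i => y /=.
    rewrite mulr0 /delta => xy; apply: xi => /=; move: xy.
    case: eqP => [->|_]; first by rewrite mdistxx.
    by have := mdist_ge0 (r x) (r y); lra.
  have -> : Negz k.+1 + 1 = Negz k by lia.
  exists (g (r x)) => y /=; rewrite mulr0 /delta; case: eqP => [->//|_] h.
  by exfalso; have := mdist_ge0 (r x) (r y); lra.
- by have [_ _ /(_ (r x))] := famP k.
- exists [:: g (r x)] => // i; rewrite inE; split => [/eqP ->//|<-]; exact: eqxx.
- exact: m_ge.
exists f; apply: coarse_embeddingI => [s|M].
  have [l sl] := m_ge (s + 3); exists (2 ^ (l + 1)) => x y xy; apply: f1.
  by apply: le_trans (delta_le x y) _; lra.
have [l Ml] := @pow2_large R M; exists (m l + 2) => x y xy.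
by have := delta_ge x y; have := f2 l x y (lt_trans xy Ml); lra.
Qed.

(** Only small scales matter, so the metric is truncated at 1 and every non-negative scale uses the
    whole space as its only member, with index 0. *)
Lemma small_scale_universality : X -> udim_le X n%:Z ->
  exists f : X -> universal R n, uniform_embedding f.
Proof.
move=> x0 Xn.
pose delta x y : R := Num.min 1 (mdist x y).
have delta_le x y (e : R) : e < 1 -> delta x y <= e -> mdist x y <= e.
  by move=> e1; rewrite /delta ge_min leNgt e1.
have /choice[F FP] : forall s : R, exists p : (nat -> set X) * R,
    0 < s -> 0 < p.2 /\ indexed_family p.1 p.2 s.
  move=> s; have [s0|s0] := ltP 0 s.
    by have [C [e [e0 Ce]]] := udim_family Xn s0; exists (C, e).
  by exists (fun=> set0, 0).
(* The ball radius 10 * eps k.+1 is thus at most half the Lebesgue number of the cover of mesh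
   [eps k], and at most 1/2, where truncation has no effect. The minimum with [eps k'] forces
   convergence to 0. *)
pose fix eps (k : nat) : R :=
  if k is k'.+1 then Num.min (eps k') (Num.min 1 (F (eps k')).2) / 20 else 20^-1.
have eps_gt0 k : 0 < eps k.
  elim: k => [|k IH] /=; first by rewrite invr_gt0.
  by rewrite divr_gt0// !lt_min IH ltr01 (FP _ IH).1.
have famP k : indexed_family (F (eps k)).1 (F (eps k)).2 (eps k) by exact: (FP _ _).2.
have epsS k : [/\ eps k.+1 <= eps k / 20, eps k.+1 <= 20^-1 &
    eps k.+1 <= (F (eps k)).2 / 20].
  have i20 : 0 <= 20^-1 :> R by rewrite invr_ge0.
  split=> /=; [|rewrite -[leRHS]mul1r|]; apply: ler_wpM2r => //;
    by rewrite !ge_min lexx ?orbT.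
have eps_lt k : eps k < 10^-1.
  case: k => [|k]; first by rewrite ltf_pV2 ?posrE// ltr_nat.
  by have [_ + _] := epsS k; lra.
have eps_small (d : R) : 0 < d -> exists k, eps k < d.
  move=> d0; exists (Num.bound d^-1).
  have epsV k : eps k * 2 ^+ k <= 1.
    elim: k => [|k IH]; first by rewrite mulr1 invf_le1// ler1n.
    have [+ _ _] := epsS k; rewrite exprS; have := exprn_gt0 k (ltr0n R 2).
    move: (2 ^+ k) IH (eps_gt0 k) => p; have := eps_gt0 k.+1.
    by move: (eps k.+1) (eps k) => a b; nra.
  have := upper_nthrootP (leqnn (Num.bound d^-1)); have := epsV (Num.bound d^-1).
  move: (eps _) (2 ^+ _) (eps_gt0 (Num.bound d^-1)) => a p a0 ap dp.
  rewrite -[d]invrK -ltf_pV2 ?posrE ?invr_gt0// invrK; apply: lt_le_trans dp _.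
  by rewrite -[leRHS]mul1r ler_pdivlMr// mulrC.
pose C (l : int) i : set X := match l with
  | Posz _ => [set x | i = 0%N] | Negz k => (F (eps k)).1 i end.
pose m (l : int) : R := if l is Negz k then eps k else 1.
have m_gt0 l : 0 < m l by case: l => //= k; exact: eps_gt0.
have delta_le1 x y : delta x y <= 1 by rewrite ge_min lexx.
have [||l|[k|k] i x y|[k|[|k]] x|[k|k] x|x|f [f1 f2]] :=
  @embedding R X n delta x0 C m.
- by move=> x; rewrite /delta mdistxx; apply/min_idPr.
- move=> x y z; rewrite /delta; have := metric_triangle x y z.
  have := mdist_ge0 x y; have := mdist_ge0 y z.
  move: (mdist x y) (mdist y z) (mdist x z) => a b c.
  by case: (leP 1 a); case: (leP 1 b); case: (leP 1 c); lra.
- exact: ltW.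
- by [].
- move=> xi yi; rewrite /delta ge_min; have [_ /(_ i _ _ xi yi) -> _] := famP k.
  by rewrite orbT.
- by exists 0%N.
- by exists 0%N.
- have -> : Negz k.+1 + 1 = Negz k by lia.
  have [/(_ x)[i xi] _ _] := famP k; exists i => y /= xy; apply: xi => /=.
  have [_ h1 h2] := epsS k; have := eps_lt k.+1.
  have := eps_gt0 k.+1; have := @delta_le x y (10 * eps k.+1); move: xy h1 h2.
  by rewrite /=; move: (eps k.+1) => *; lra.
- by exists [:: 0%N] => // i; rewrite inE; split=> /eqP.
- by have [_ _ /(_ x)] := famP k.
- by exists 0; exact: delta_le1.
exists f; apply: uniform_embeddingI => [e e0|d d0].
  have [l le] := pow2_small e0; exists (m (l - 1)) => // x y xy.
  apply: le_trans (ltW le); rewrite -[l](subrK 1); apply: f1.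
  by rewrite ge_min xy orbT.
have [k kd] := eps_small d d0; exists (2 ^ (Negz k)); first exact: pow2_gt0.
move=> x y /f2 /= /delta_le; move=> /(_ _)/le_lt_trans; apply => //.
by have := eps_lt k; lra.
Qed.

End universality.

Theorem theorem1p1 (R : realType) (n : nat) :
  exists U : metricType R,
    [/\ separable U, asdim_eq U n%:Z, udim_eq U n%:Z &
        forall X : metricType R, separable X ->
          (asdim_le X n%:Z -> coarsely_equivalent_to_subset X U) /\
          (udim_le X n%:Z -> uniformly_homeomorphic_to_subset X U)].
Proof.
exists (universal R n); split.
- exact: separable_universal.
- split; first exact: asdim_universal.
  (* Any single scale suffices: a cover witnessing dimension n - 1 in either sense has finite mesh
     and a positive Lebesgue number. *)
  by move=> /(_ 0)[W [_ [e _ We] Wfin]]; exact: no_small_cover We Wfin.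
- split; first exact: udim_universal.
  move=> /(_ 1 ltr01)[W [_ W1 [e We]]]; apply: no_small_cover We _.
  exact: lt_trans W1 (ltry _).
move=> X Xs; have [[x0]|X0] := pselect (inhabited X).
  split=> [/(large_scale_universality Xs x0)|/(small_scale_universality Xs x0)] [f fP].
    exact: coarsely_equivalent_range fP.
  exact: uniformly_homeomorphic_range fP.
(* The empty space has no base point and is treated apart. *)
pose f (x : X) : universal R n := of_thread R (thread0 n).
have noX (x : X) : False by apply: X0; exists.
split=> _.
  apply: (@coarsely_equivalent_range _ _ _ f).
  by apply: coarse_embeddingI => ?; exists 0 => x; case: (noX x).
apply: (@uniformly_homeomorphic_range _ _ _ f).
by apply: uniform_embeddingI => ? _; exists 1 => // x; case: (noX x).
Qed.
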